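(* Let $C$ be an irreducible and reduced projective Gorenstein rational curve over $\mathbb{C}$ of arithmetic genus $g$ with a unique singular point, which is unibranch. Fix a smooth point $P_0\in C$ and an affine coordinate $u$ on the normalization $\mathbb{P}^1$ such that $P_0$ corresponds to $u=0$ and the singular point to $u=\infty$. Fix a basis $\omega_1,\dots,\omega_g$ of $H^0(C,\omega_C)$ and write $\omega_j=\big(\sum_{i\ge0}a_{ij}u^i\big)du$ (finite sums); let $A$ be the matrix with $g$ rows such that $(A\mathbf x)_j=\sum_{i\ge0}a_{ij}x_{i+1}$ for $\mathbf x=(x_1,x_2,\dots)^t$. Let $\tau(\mathbf x)$ be the tau function of the frame $\iota(\omega_1),\dots,\iota(\omega_g),\iota(\omega_{g+1}),\dots$, where $\omega_{g+i}=u^{-i-1}du$ for $i\ge1$, and let $\theta(z_1,\dots,z_g)$ be a (polynomial) theta function of $C$ coming from the Abel map with base point $P_0$ and the basis $\omega_1,\dots,\omega_g$. Then $$\tau(\mathbf x)=\exp(c_0)\cdot\theta(A\mathbf x)$$ for a certain $c_0\in\mathbb{C}$.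
   Context: Theta function. $\nu:\mathbb P^1\to C$ is the normalization; unibranch means that the singular point has a single preimage. Sections of the dualizing sheaf $\omega_C$ are the meromorphic differentials $\omega$ on $\mathbb P^1$ with $\sum_{Q\in\nu^{-1}(P)}\operatorname{Res}_Q(\nu^*(f)\omega)=0$ for all $P\in C$, $f\in\mathcal O_{C,P}$; here they have the form $F(u)du$ with $F$ a polynomial. Let $C_0$ be the smooth locus. For these curves the period group (image of $H_1(C_0,\mathbb Z)$ in $H^0(C,\omega_C)^*$) is zero and $\operatorname{Jac}(C)=H^0(C,\omega_C)^*\cong\mathbb C^g$ via the basis. The theta divisor is the Zariski closure in $\mathbb C^g$ of the image of $C_0^{g-1}$ under $(P_1,\dots,P_{g-1})\mapsto\big(\sum_{k}\int_{P_0}^{P_k}\omega_j\big)_{j=1,\dots,g}$, and a theta function $\theta$ is a reduced polynomial whose zero divisor is the theta divisor (unique up to a nonzero scalar). Tau functions. A frame is a sequence $f_j=\sum_i\xi_{i,j}u^{i+1}\in\mathbb C(\!(u)\!)$ ($j\ge1$), linearly independent, for which there is $\ell$ with $\xi_{-j,j}=1$, $\xi_{i,j}=0$ for $i<-j$ whenever $j>\ell$, and $\xi_{i,j}=0$ for $i<-\ell$ whenever $j\le\ell$. For a partition $\lambda$ put $m_i=\lambda_i-i$ and $\xi_\lambda=\det(\xi_{m_i,j})_{i,j\ge1}$ (the stable value of the $N\times N$ truncations, $N\gg0$). Define $\sigma_i(\mathbf x)$ by $\exp(\sum_{i\ge1}x_it^i)=\sum_{i\ge0}\sigma_i(\mathbf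 x)t^i$ (and $\sigma_i=0$ for $i<0$), and the Schur–Weierstrass polynomial $\sigma_\lambda(\mathbf x)=\det(\sigma_{\lambda_i+j-i}(\mathbf x))_{1\le i,j\le m}$ for $\lambda=(\lambda_1,\dots,\lambda_m)$. The tau function of the frame is $\tau(\mathbf x)=\sum_\lambda\xi_\lambda\sigma_\lambda(\mathbf x)$ (sum over all partitions). The map $\iota$ is $\iota(f(u)du)=u^{2-g}f(u)$; the frame above spans $\iota(H^0(C,L(\infty P_0)))$, where $L=\omega_C(-(g-1)P_0)$ and $H^0(C,L(\infty P_0))=\bigcup_{n\ge0}H^0(C,L(nP_0))$. *)

(* Defs.v *)
Set Warnings "-all".
From HB Require Import structures.
From mathcomp Require Import all_boot all_order all_algebra.
From mathcomp Require Import complex.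
From mathcomp Require monalg mpoly.
(* The notations of monalg and mpoly clash with those of mathcomp-analysis. *)
Import -(notations) monalg.
Import -(notations) mpoly.
From mathcomp Require Import all_classical all_reals all_analysis.
From mathcomp Require Import ring zify.
Import Order.TTheory GRing.Theory Num.Theory.
Import numFieldNormedType.Exports.

Set Implicit Arguments.
Unset Strict Implicit.
Unset Printing Implicit Defensive.

Local Open Scope classical_set_scope.
Local Open Scope ring_scope.

(* Closed points of the projective line over the complex numbers R[i], with
   affine coordinate u: [Some a] is the point u = a, [None] is u = oo. *)
Definition P1 (R : realType) := option R[i].

Definition ratfun (R : realType) := {fraction {poly R[i]}}.

Definition of_poly (R : realType) (p : {poly R[i]}) : ratfun R := tofrac p.
Definition cst (R : realType) (c : R[i]) : ratfun R := of_poly c%:P.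
Definition u_ (R : realType) : ratfun R := of_poly 'X.

Definition regular_at (R : realType) (Q : P1 R) : set (ratfun R) :=
  match Q with
  | Some a => [set f | exists p q : {poly R[i]},
                 q.[a] != 0 /\ f = of_poly p / of_poly q]
  | None => [set f | exists p q : {poly R[i]},
                 [/\ q != 0, (size p <= size q)%N & f = of_poly p / of_poly q]]
  end.

(* [has_residue Q F c]: the differential F(u)du has residue c at Q.  The
   polar part is split into its residue term and the terms of order >= 2.
   At u = oo, with t = 1/u, one has u^k du = - t^(-k-2) dt, so the residue
   is minus the coefficient of 1/u in F. *)
Definition has_residue (R : realType) (Q : P1 R) (F : ratfun R) (c : R[i]) :
    Prop :=
  match Q with
  | Some a => exists (s : {poly R[i]}) (h : ratfun R),
      regular_at (Some a) h /\
      let v := (u_ R - cst a)^-1 in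
      F = (map_poly (@cst R) s).[v] * v ^+ 2 + cst c * v + h
  | None => exists (s : {poly R[i]}) (h : ratfun R),
      regular_at None h /\
      F = of_poly s - cst c * (u_ R)^-1 + h * (u_ R) ^- 2
  end.

Definition residue (R : realType) (Q : P1 R) (F : ratfun R) : R[i] :=
  xget 0 [set c | has_residue Q F c].

(* [nu] is an isomorphism over a neighbourhood of P, that is, P is a normal
   (equivalently smooth) point. *)
Definition smooth_point (R : realType) (T : Type) (nu : P1 R -> T)
    (O : T -> set (ratfun R)) (P : T) : Prop :=
  exists Q, (forall Q', nu Q' = P <-> Q' = Q) /\ O P = regular_at Q.

(* An irreducible and reduced projective curve with normalization
   nu : P^1 -> C is presented by its closed points, the map nu, and its
   structure sheaf, as a sheaf of subrings of the constant sheaf of rational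
   functions, given by its local rings (Serre, Groupes algebriques et corps
   de classes, IV.1).  Every such datum comes from a unique projective curve:
   - [curve_local] says that an element of O_P which does not vanish at some
     point Q over P is invertible in O_P, so that O_P is local with maximal
     ideal the functions vanishing on nu^-1(P);
   - [curve_finite] says that the normalization of O_P (the ring of functions
     regular on nu^-1(P)) is finite over O_P with the same fraction field,
     i.e. that the conductor is not zero. *)
Record rational_curve (R : realType) := RationalCurve {
  point_of : Type;
  nu : P1 R -> point_of;
  locring : point_of -> set (ratfun R);
  nu_surj : forall P, exists Q, nu Q = P;
  nu_finite : forall P, finite_set [set Q | nu Q = P];
  locring_cst : forall P c, locring P (cst c);
  locring_sub : forall P f h, locring P f -> locring P h -> locring P (f - h);
  locring_mul : forall P f h, locring P f -> locring P h -> locring P (f * h);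
  locring_regular : forall P f Q, locring P f -> nu Q = P -> regular_at Q f;
  curve_local : forall P f Q, locring P f -> nu Q = P ->
    regular_at Q f^-1 -> locring P f^-1;
  curve_finite : forall P, exists2 d, d != 0 &
    forall f, (forall Q, nu Q = P -> regular_at Q f) -> locring P (d * f);
  curve_generic : finite_set [set P | ~ smooth_point nu locring P]
}.

Definition smooth (R : realType) (C : rational_curve R) (P : point_of C) :
  Prop := smooth_point (@nu R C) (@locring R C) P.

(* H^1(C, O_C) is the space of repartitions (elements of K^C lying in O_P for
   almost all P) modulo K + \prod_P O_P; this is the cokernel of
   K -> \bigoplus_P K/O_P.  As H^0(C, O_C) is the field of constants, the
   arithmetic genus is the dimension of H^1(C, O_C). *)
Definition repartition (R : realType) (C : rational_curve R)
    (r : point_of C -> ratfun R) : Prop :=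
  finite_set [set P | ~ locring P (r P)].

Definition arithmetic_genus (R : realType) (C : rational_curve R) (g : nat) :
    Prop :=
  exists e : 'I_g -> point_of C -> ratfun R,
    (forall i, repartition (e i)) /\
    forall r, repartition r ->
      exists! c : 'rV[R[i]]_g, exists h : ratfun R,
        forall P, locring P (r P - \sum_i cst (c 0 i) * e i P - h).

(* The stalk at P of the dualizing sheaf; F stands for F(u)du. *)
Definition omega_stalk (R : realType) (C : rational_curve R) (P : point_of C) :
    set (ratfun R) :=
  [set F | forall f, locring P f ->
     \sum_(Q \in [set Q | nu C Q = P]) residue Q (f * F) = 0].

Definition H0omega (R : realType) (C : rational_curve R) : set (ratfun R) :=
  [set F | forall P : point_of C, omega_stalk P F].

(* The dualizing sheaf is invertible. *)
Definition gorenstein (R : realType) (C : rational_curve R) : Prop :=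
  forall P : point_of C, exists F0 : ratfun R, forall F : ratfun R,
    omega_stalk P F <-> exists2 f, locring P f & F = f * F0.

Definition is_basis_of (R : realType) (V : set (ratfun R)) (g : nat)
    (w : 'I_g -> ratfun R) : Prop :=
  (forall j, V (w j)) /\
  forall F, V F -> exists! c : 'rV[R[i]]_g, F = \sum_j cst (c 0 j) * w j.

(* Integral of F(u)du along the segment from u = 0 to u = p. *)
Definition segment_integral (R : realType) (F : {poly R[i]}) (p : R[i]) :
    R[i] :=
  let f (t : R) := F.[(t%:C)%C * p] * p in
  Complex (\int[lebesgue_measure]_(t in `[0%R, 1%R]) complex.Re (f t))
          (\int[lebesgue_measure]_(t in `[0%R, 1%R]) complex.Im (f t)).

(* Image of C_0^(g-1) under the Abel map with base point nu(0), for the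
   differentials a_j(u)du. *)
Definition abel_image (R : realType) (C : rational_curve R) (g : nat)
    (a : 'I_g -> {poly R[i]}) : set ('I_g -> R[i]) :=
  [set z | exists p : 'I_g.-1 -> R[i],
     (forall k, smooth (nu C (Some (p k)))) /\
     forall j, z j = \sum_k segment_integral (a j) (p k)].

Definition zariski_closure (R : realType) (g : nat) (S : set ('I_g -> R[i])) :
    set ('I_g -> R[i]) :=
  [set z | forall p : mpoly g R[i],
     (forall s, S s -> meval s p = 0) -> meval z p = 0].

(* The quotient ring by the ideal of q has no nonzero nilpotent. *)
Definition reduced_mpoly (R : realType) (g : nat) (q : mpoly g R[i]) : Prop :=
  forall (p : mpoly g R[i]) (n : nat),
    (exists r, p ^+ n = r * q) -> exists r, p = r * q.

Definition is_theta (R : realType) (C : rational_curve R) (g : nat)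
    (a : 'I_g -> {poly R[i]}) (theta : mpoly g R[i]) : Prop :=
  [/\ theta != 0, reduced_mpoly theta &
      [set z | meval z theta = 0] = zariski_closure (abel_image C a)].

Definition laurent (R : realType) := int -> R[i].

(* Frames are indexed from 0: [f j] is f_(j+1); [xi f i j] is xi_(i,j+1). *)
Definition xi (R : realType) (f : nat -> laurent R) (i : int) (j : nat) :
  R[i] := f j (i + 1).

Definition is_frame (R : realType) (f : nat -> laurent R) : Prop :=
  (forall n (c : 'I_n -> R[i]),
     (forall k, \sum_j c j * f j k = 0) -> forall j, c j = 0) /\
  exists l : nat, forall j : nat,
    if (l < j.+1)%N
    then xi f (- j.+1%:Z) j = 1 /\ forall i : int, i < - j.+1%:Z -> xi f i j = 0
    else forall i : int, i < - l%:Z -> xi f i j = 0.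

Definition is_partition (l : seq nat) : bool := sorted geq l && (0%N \notin l).

(* xi_lambda: the stable value of the N x N truncations for N >> 0. *)
Definition xi_part (R : realType) (f : nat -> laurent R) (l : seq nat) : R[i] :=
  xget 0 [set c | exists N0, forall N, (N0 <= N)%N ->
    \det (\matrix_(i < N, j < N) xi f ((nth 0%N l i)%:Z - i.+1%:Z) j) = c].

(* In the definitions below [x i] stands for x_(i+1), in any commutative
   algebra.  [sigma x n] is the coefficient of t^n in exp(\sum_i x_i t^i);
   the x_i with i > n and the k-th powers with k > n do not contribute. *)
Definition sigma (R : realType) (A : comAlgType R[i]) (x : nat -> A) (n : nat) :
    A :=
  \sum_(k < n.+1) (k`!%:R : R[i])^-1 *:
    ((\poly_(i < n.+1) (if i is i'.+1 then x i' else 0)) ^+ k)`_n.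

Definition sigmaz (R : realType) (A : comAlgType R[i]) (x : nat -> A)
    (n : int) : A :=
  if n is Posz m then sigma x m else 0.

Definition schur_weierstrass (R : realType) (A : comAlgType R[i])
    (x : nat -> A) (l : seq nat) : A :=
  \det (\matrix_(i < size l, j < size l)
    sigmaz x ((nth 0%N l i)%:Z + j%:Z - i%:Z)).

Definition xpoly (R : realType) := malg (cmonom nat) R[i].

Definition xvar (R : realType) (i : nat) : xpoly R := mkmalgU (ucm i) 1.

Definition xseries (R : realType) := cmonom nat -> R[i].

Definition series_of_xpoly (R : realType) (p : xpoly R) : xseries R :=
  fun m => monalg.mcoeff m p.

(* For each monomial m the sum is finite: the Schur-Weierstrass polynomial of
   l is homogeneous of degree |l| when x_i has weight i. *)
Definition tau (R : realType) (f : nat -> laurent R) : xseries R :=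
  fun m => \sum_(l \in [set l | is_partition l])
    xi_part f l * monalg.mcoeff m (schur_weierstrass (@xvar R) l).

Definition laurent_of_poly (R : realType) (p : {poly R[i]}) : laurent R :=
  fun k => if k is Posz n then p`_n else 0.

Definition monomial (R : realType) (d : int) : laurent R :=
  fun k => (k == d)%:R.

(* The 0-based sequence a_1 du, ..., a_g du, u^-2 du, u^-3 du, ... *)
Definition omega_seq (R : realType) (g : nat) (a : 'I_g -> {poly R[i]})
    (j : nat) : laurent R :=
  if (insub j : option 'I_g) is Some j' then laurent_of_poly (a j')
  else monomial R (- (j - g).+1%:Z - 1).

(* f(u)du |-> u^(2-g) f(u) *)
Definition iota_map (R : realType) (g : nat) (f : laurent R) : laurent R :=
  fun k => f (k - (2 - g%:Z)).

Definition curve_frame (R : realType) (g : nat) (a : 'I_g -> {poly R[i]}) :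
    nat -> laurent R :=
  fun j => iota_map g (omega_seq a j).

Definition period_matrix_mul (R : realType) (g : nat)
    (a : 'I_g -> {poly R[i]}) (A : comAlgType R[i]) (x : nat -> A) (j : 'I_g) :
    A :=
  \sum_(i < size (a j)) (a j)`_i *: x i.

Definition theta_at (R : realType) (g : nat) (theta : mpoly g R[i])
    (A : comAlgType R[i]) (z : 'I_g -> A) : A :=
  mpoly.mmap (in_alg A) z theta.

Definition cexp (R : realType) (z : R[i]) : R[i] :=
  Complex (expR (complex.Re z) * cos (complex.Im z))
          (expR (complex.Re z) * sin (complex.Im z)).

Lemma curve_frame_xi (R : realType) (g : nat) (a : 'I_g -> {poly R[i]}) i j :
  xi (curve_frame a) i j = omega_seq a j (i + g%:Z - 1).
Proof. by rewrite /xi /curve_frame /iota_map; congr omega_seq; ring. Qed.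

(* [tau] takes any sequence; this lemma shows that it is used on a frame. *)
Lemma curve_frameP (R : realType) (g : nat) (a : 'I_g -> {poly R[i]}) :
  (forall c : 'I_g -> R[i], \sum_j c j *: a j = 0 -> forall j, c j = 0) ->
  is_frame (curve_frame a).
Proof.
move=> afree; split=> [n c c0|]; last first.
  exists g => j; case: ifPn => [gj|].
    have jg : (insub j : option 'I_g) = None by rewrite insubN // -leqNgt -ltnS.
    split=> [|i ilt]; rewrite curve_frame_xi /omega_seq jg /monomial.
      by have -> : - j.+1%:Z + g%:Z - 1 = - (j - g).+1%:Z - 1;
        [lia | rewrite eqxx].
    by case: eqP => // ij; move: ilt; rewrite ltNge; case/negP; lia.
  rewrite -ltnNge ltnS => jg i ilt.
  rewrite curve_frame_xi /omega_seq insubT /laurent_of_poly /=.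
  by have: i + g%:Z - 1 < 0 by [lia]; case: (i + g%:Z - 1).
have cneg (j : 'I_n) : (g <= j)%N -> c j = 0.
  move=> gj; have := c0 (- j%:Z); rewrite (bigD1 j) //= big1 => [|k kj].
    have jg : (insub (j : nat) : option 'I_g) = None by rewrite insubN // -leqNgt.
    rewrite addr0 /curve_frame /iota_map /omega_seq jg /monomial.
    have -> : - j%:Z - (2 - g%:Z) = - (j - g).+1%:Z - 1 by lia.
    by rewrite eqxx mulr1.
  rewrite /curve_frame /iota_map /omega_seq; case: insubP => [k' _ _|].
    rewrite /laurent_of_poly.
    have: - j%:Z - (2 - g%:Z) < 0 by lia.
    by case: (- j%:Z - (2 - g%:Z)) => // m _; rewrite mulr0.
  rewrite -leqNgt => gk; rewrite /monomial; case: eqP => [e|]; last by rewrite mulr0.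
  by case/eqP: kj; apply/val_inj => /=; lia.
pose c' (j : 'I_g) := if (insub (j : nat) : option 'I_n) is Some i then c i else 0.
have c'0 : \sum_j c' j *: a j = 0.
  apply/polyP => d; rewrite coef0 coef_sum -[RHS](c0 (d%:Z + (2 - g%:Z))).
  rewrite (bigID (fun j : 'I_n => (j < g)%N)) /= [X in _ = _ + X]big1 => [|j]; last first.
    by rewrite -leqNgt => /cneg ->; rewrite mul0r.
  rewrite addr0 [LHS](bigID (fun j : 'I_g => (j < n)%N)) /=.
  rewrite [X in _ + X = _]big1 => [|j]; last first.
    by move=> jn; rewrite /c' insubN // scale0r coef0.
  rewrite addr0.
  pose F (k : nat) : R[i] :=
    if (insub k : option 'I_n) is Some i then c i * curve_frame a k (d%:Z + (2 - g%:Z)) else 0.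
  transitivity (\sum_(0 <= k < g | (k < n)%N) F k).
    rewrite big_mkord; apply: eq_bigr => j jn.
    rewrite /F /c' insubT coefZ /curve_frame /iota_map addrK /omega_seq.
    by rewrite valK.
  transitivity (\sum_(0 <= k < n | (k < g)%N) F k); last first.
    by rewrite big_mkord; apply: eq_bigr => j jg; rewrite /F valK.
  rewrite [LHS](big_nat_widen _ _ (g + n)) ?leq_addr //.
  rewrite [RHS](big_nat_widen _ _ (g + n)) ?leq_addl //.
  by apply: eq_bigl => k; rewrite andbC.
move=> j; have [jg|] := ltnP j g; last exact: cneg.
by have := afree _ c'0 (Ordinal jg); rewrite /c' /= valK.
Qed.

(* Main.v *)
(* Only partitions with exactly g parts contribute to tau, and by the Cauchy-Binet
   formula tau(x) is the determinant of the pairing of omega_1, ..., omega_g with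
   g consecutive shifts of exp(\sum_i x_i t^i).

   Put t = 1/u.  By duality, a series y(t) = \sum_i y_i t^i is orthogonal to all
   the omega_j exactly when it lies in the local ring of the singular point; then
   so does exp(y), and it acts on H^0(C, omega) modulo regular terms by a
   unipotent matrix.  Hence tau is invariant under translation by the kernel of A,
   that is, tau(x) = T(Ax) for a polynomial T.

   For a complex number p let [p] = (p, p^2/2, p^3/3, ...), so that
   exp(\sum_i [p]_i t^i) is 1 / (1 - p t) and A[p] is the Abel image of p.  Column
   operations show that tau vanishes on sums of g - 1 points, that tau(x - [s]) has degree at most g in s,
   and that tau does not vanish on a generic sum of g points.  So T vanishes on
   the theta divisor, theta divides T by the Nullstellensatz and reducedness, and
   for generic x = [p_1] + ... + [p_g] both T(Ax - A[s]) and theta(Ax - A[s]) are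
   multiples of the product of the s - p_i.  The cofactor T / theta is therefore
   invariant under translation by A[s]; since the sums of g points are dense in
   C^g, it is constant. *)
Require Import Defs.
Set Warnings "-all".
From HB Require Import structures.
From mathcomp Require Import all_boot all_order all_algebra.
From mathcomp Require Import perm complex.
From mathcomp Require monalg mpoly.
Import -(notations) monalg.
Import -(notations) mpoly.
From mathcomp Require Import all_classical all_reals all_analysis.
From mathcomp Require Import ring zify.
Import Order.TTheory GRing.Theory Num.Theory.
Import numFieldNormedType.Exports.

Set Implicit Arguments.
Unset Strict Implicit.
Unset Printing Implicit Defensive.

Local Open Scope classical_set_scope.
Local Open Scope ring_scope.

(** * Polynomial functions *)

Section MultivariatePolynomials.

Variable K : numFieldType.

Lemma poly_eq0 (p : {poly K}) : (forall s, p.[s] = 0) -> p = 0.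
Proof.
move=> p0; apply/eqP/contraT => pn0.
have := max_poly_roots pn0 (rs := [seq k%:R | k <- iota 0 (size p)]).
rewrite size_map size_iota ltnn => -> //.
  by apply/allP => x _; rewrite rootE p0.
by rewrite map_inj_uniq ?iota_uniq // => j k /eqP; rewrite eqr_nat => /eqP.
Qed.

(** In characteristic 0, a monomial of p with a positive exponent at i leaves a nonzero term in
    [mderiv i p]. *)
Lemma mderiv_eq0 n (p : mpoly n K) :
  (forall i, mderiv i p = 0) -> p = mpolyC n (mcoeff mnm0 p).
Proof.
move=> dp0; apply/mpolyP => m; rewrite mcoeffC.
have [->|mn0] := eqVneq m mnm0; first by rewrite mulr1.
rewrite mulr0.
have [i mi] : exists i, (0 < m i)%N.
  apply/existsP; apply/contraT; rewrite negb_exists => /forallP m0.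
  case/eqP: mn0; apply/mnmP => i; rewrite mnm0E.
  by apply/eqP; rewrite -leqn0 leqNgt m0.
have: mcoeff (mnm_sub m (mnm1 i)) (mderiv i p) = 0 by rewrite dp0 mcoeff0.
rewrite mcoeff_mderiv submK; last by rewrite lep1mP -lt0n.
by move/eqP; rewrite mulrn_eq0 /= => /eqP.
Qed.

Lemma msize_mderiv n i (p : mpoly n K) : p != 0 ->
  (mmeasure (@mdeg n) (mderiv i p) < mmeasure (@mdeg n) p)%N.
Proof.
move=> pn0; have s0 : (0 < mmeasure (@mdeg n) p)%N.
  by rewrite lt0n mmeasure_poly_eq0.
rewrite -(prednK s0) ltnS mmeasureE big_seq; apply/bigmax_leqP_seq => m.
move=> + _; rewrite mcoeff_msupp mcoeff_mderiv mulrn_eq0 /= => mp.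
have := @msize_mdeg_lt _ _ p (mnm_add m (mnm1 i)).
rewrite mcoeff_msupp mp => /(_ isT).
by rewrite mdegD mdeg1 addn1 -{1}(prednK s0) ltnS.
Qed.

(** Differentiation lowers the degree until only constants remain. A vanishing criterion is thus
    reduced to its stability under partial derivatives. *)
Lemma mderiv_ind0 n (P : mpoly n K -> Prop) :
  (forall p i, P p -> P (mderiv i p)) -> (forall c, P (mpolyC n c) -> c = 0) ->
  forall p, P p -> p = 0.
Proof.
move=> Pd Pc p; have [m] := ubnP (mmeasure (@mdeg n) p).
elim: m p => // m IHm p pm Pp; have [//|pn0] := eqVneq p 0.
have pE : p = mpolyC n (mcoeff mnm0 p).
  apply: mderiv_eq0 => i; apply: IHm; last exact: Pd.
  by apply: leq_trans (msize_mderiv i pn0) _; rewrite -ltnS.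
by move: Pp; rewrite pE => /Pc ->; rewrite mpolyC0.
Qed.

Lemma horner_mmap n (h : 'I_n -> {poly K}) (p : mpoly n K) s :
  (mmap polyC h p).[s] = meval (fun i => (h i).[s]) p.
Proof.
rewrite /mmap horner_sum mevalE; apply: eq_bigr => m _.
rewrite hornerM hornerC /mmap1 horner_prod; congr (_ * _).
by apply: eq_bigr => i _; rewrite horner_exp.
Qed.

(** Chain rule along the curve h. The identity is stable under sums and products, so constants and
    variables suffice. *)
Lemma deriv_mmap n (h : 'I_n -> {poly K}) (p : mpoly n K) :
  (mmap polyC h p)^`() = \sum_i mmap polyC h (mderiv i p) * (h i)^`().
Proof.
pose P q := (mmap polyC h q)^`() = \sum_i mmap polyC h (mderiv i q) * (h i)^`().
have PC c : P (mpolyC n c).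
  rewrite /P mmapC derivC big1 // => i _.
  by rewrite mderivC mmap0 mul0r.
have PD q r : P q -> P r -> P (q + r).
  rewrite /P mmapD derivD => -> ->; rewrite -big_split; apply: eq_bigr => i _.
  by rewrite mderivD mmapD mulrDl.
have PM q r : P q -> P r -> P (q * r).
  rewrite /P rmorphM derivM => -> ->.
  rewrite mulr_suml mulr_sumr -big_split; apply: eq_bigr => i _ /=.
  rewrite mderivM mmapD !rmorphM /=.
  by ring.
have PX i : P (mpolyX K (mnm1 i)).
  rewrite /P mmapX mmap1U (bigD1 i) //= big1 => [|j ji]; last first.
    by rewrite mderivX mnm1E eq_sym (negPf ji) scale0r mmap0 mul0r.
  rewrite mderivX mnm1E eqxx scale1r.
  have -> : mnm_sub (mnm1 i) (mnm1 i) = mnm0.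
    by apply/mnmP => j; rewrite mnmBE mnm0E subnn.
  by rewrite mpolyX0 rmorph1 mul1r addr0.
rewrite [p]mpolyE; elim/big_ind: _ => [||m _]; last 1 first.
- rewrite -mul_mpolyC; apply: (PM) => //; rewrite mpolyXE_id.
  elim/big_ind: _ => //; first exact: (PC 1).
  move=> i _; elim: (m i) => [|k IH]; first by rewrite expr0; exact: (PC 1).
  by rewrite exprS; apply: PM.
- by have := PC 0; rewrite mpolyC0.
- exact: PD.
Qed.

(** Polynomiality is carried as a property of functions, so that determinants and compositions need
    no explicit polynomial. *)
Definition polyfun n (F : ('I_n -> K) -> K) : Prop :=
  exists p : mpoly n K, forall v, F v = meval v p.

Lemma polyfun_cst n c : @polyfun n (fun=> c).
Proof. by exists (mpolyC n c) => v; rewrite mevalC. Qed.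

Lemma polyfun_var n i : @polyfun n (fun v => v i).
Proof. by exists (mpolyX K (mnm1 i)) => v; rewrite mevalXU. Qed.

Lemma polyfunD n (F G : ('I_n -> K) -> K) :
  polyfun F -> polyfun G -> polyfun (fun v => F v + G v).
Proof. by move=> [p Fp] [q Gq]; exists (p + q) => v; rewrite mevalD Fp Gq. Qed.

Lemma polyfunM n (F G : ('I_n -> K) -> K) :
  polyfun F -> polyfun G -> polyfun (fun v => F v * G v).
Proof. by move=> [p Fp] [q Gq]; exists (p * q) => v; rewrite mevalM Fp Gq. Qed.

Lemma polyfunN n (F : ('I_n -> K) -> K) : polyfun F -> polyfun (fun v => - F v).
Proof. by move=> [p Fp]; exists (- p) => v; rewrite mevalN Fp. Qed.

Lemma polyfun_sum n I (r : seq I) (P : pred I) (F : I -> ('I_n -> K) -> K) :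
  (forall i, P i -> polyfun (F i)) -> polyfun (fun v => \sum_(i <- r | P i) F i v).
Proof.
move=> PF; elim: r => [|i r IH].
  by case: (polyfun_cst n 0) => p pE; exists p => v; rewrite -pE big_nil.
have [Pi|nPi] := boolP (P i).
  case: (polyfunD (PF i Pi) IH) => p pE.
  by exists p => v; rewrite -pE big_cons Pi.
by case: IH => p pE; exists p => v; rewrite -pE big_cons (negPf nPi).
Qed.

Lemma polyfun_prod n I (r : seq I) (P : pred I) (F : I -> ('I_n -> K) -> K) :
  (forall i, P i -> polyfun (F i)) -> polyfun (fun v => \prod_(i <- r | P i) F i v).
Proof.
move=> PF; elim: r => [|i r IH].
  by case: (polyfun_cst n 1) => p pE; exists p => v; rewrite -pE big_nil.
have [Pi|nPi] := boolP (P i).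
  case: (polyfunM (PF i Pi) IH) => p pE.
  by exists p => v; rewrite -pE big_cons Pi.
by case: IH => p pE; exists p => v; rewrite -pE big_cons (negPf nPi).
Qed.

Lemma polyfunX n (F : ('I_n -> K) -> K) k : polyfun F -> polyfun (fun v => F v ^+ k).
Proof. by move=> [p pE]; exists (p ^+ k) => v; rewrite pE rmorphXn. Qed.

Lemma polyfun_horner n (q : {poly K}) (F : ('I_n -> K) -> K) :
  polyfun F -> polyfun (fun v => q.[F v]).
Proof.
move=> PF; rewrite (_ : (fun _ => _) =
    fun v => \sum_(i < size q) q`_i * F v ^+ i); last first.
  by apply/funext => v; rewrite horner_coef.
by apply: polyfun_sum => i _; apply: polyfunM; [exact: polyfun_cst|exact: polyfunX].
Qed.

Lemma polyfun_meval n m (p : mpoly m K) (F : 'I_m -> ('I_n -> K) -> K) :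
  (forall i, polyfun (F i)) -> polyfun (fun v => meval (fun i => F i v) p).
Proof.
move=> PF; rewrite (_ : (fun _ => _) = fun v =>
    \sum_(k <- msupp p) mcoeff k p * \prod_i F i v ^+ k i); last first.
  by apply/funext => v; rewrite mevalE.
apply: polyfun_sum => k _; apply: polyfunM; first exact: polyfun_cst.
by apply: polyfun_prod => i _; exact: polyfunX.
Qed.

Lemma polyfun_det n m (F : 'I_m -> 'I_m -> ('I_n -> K) -> K) :
  (forall i j, polyfun (F i j)) -> polyfun (fun v => \det (\matrix_(i, j) F i j v)).
Proof.
move=> PF; rewrite (_ : (fun _ => _) = fun v =>
    \sum_(s : 'S_m) (-1) ^+ s * \prod_i F i (s i) v); last first.
  apply/funext => v; apply: eq_bigr => s _; congr (_ * _).
  by apply: eq_bigr => i _; rewrite mxE.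
apply: polyfun_sum => s _; apply: polyfunM; first exact: polyfun_cst.
by apply: polyfun_prod.
Qed.

Definition update n (v : 'I_n -> K) i s : 'I_n -> K :=
  fun j => if j == i then s else v j.

Lemma meval_eq0 n (p : mpoly n K) : (forall v, meval v p = 0) -> p = 0.
Proof.
move: p; apply: mderiv_ind0 => [p i p0 v|c /(_ (fun=> 0))]; last by rewrite mevalC.
(* h parametrizes the line through v in the direction i. *)
pose h j : {poly K} := if j == i then 'X else (v j)%:P.
have hi : (fun j => (h j).[v i]) = v.
  by apply/funext => j; rewrite /h; case: eqP => [->|_]; rewrite ?hornerX ?hornerC.
have h0 : mmap polyC h p = 0.
  by apply: poly_eq0 => x; rewrite horner_mmap p0.
have := deriv_mmap h p; rewrite h0 deriv0 => /(congr1 (fun q => q.[v i])).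
rewrite horner0 (bigD1 i) //= big1 => [|j ji]; last first.
  by rewrite /h (negPf ji) derivC mulr0.
by rewrite addr0 {2}/h eqxx derivX mulr1 horner_mmap hi.
Qed.

(** Polynomials form an integral domain. This serves to remove genericity conditions, expressed by
    the nonvanishing of G. *)
Lemma polyfunM_eq0 n (F G : ('I_n -> K) -> K) : polyfun F -> polyfun G ->
  (forall v, F v * G v = 0) -> (exists v, G v != 0) -> forall v, F v = 0.
Proof.
move=> [p pE] [q qE] FG0 [w Gw] v.
have /eqP : p * q = 0 by apply: meval_eq0 => x; rewrite mevalM -pE -qE.
rewrite mulf_eq0 => /orP[] /eqP e0; first by rewrite pE e0 meval0.
by move: Gw; rewrite qE e0 meval0 eqxx.
Qed.

End MultivariatePolynomials.

(** * Generic points of polynomial curves and density of their sums *)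

Section CharacteristicZero.

Variable K : numFieldType.

(** The coefficient matrix has rank g, and multiplication by an invertible Vandermonde matrix
    preserves it. Hence g of the evaluation columns are independent. *)
Lemma evaluation_det_neq0 g (a : 'I_g -> {poly K}) :
  (forall c : 'I_g -> K, \sum_j c j *: a j = 0 -> forall j, c j = 0) ->
  exists p : 'I_g -> K, (forall i, p i != 0) /\
    \det (\matrix_(j, i) (a j).[p i]) != 0.
Proof.
move=> afree; pose M := \max_j size (a j).
have aM j : (size (a j) <= M)%N by exact: (leq_bigmax j).
pose A := \matrix_(j < g, i < M) (a j)`_i.
have Afree : row_free A.
  apply/inj_row_free => v vA0; apply/rowP => j; rewrite mxE.
  apply: (afree (fun j => v 0 j)); apply/polyP => k; rewrite coef_sum coef0.
  have [kM|Mk] := ltnP k M; last first.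
    by rewrite big1 // => i _; rewrite coefZ nth_default ?mulr0 // (leq_trans _ Mk).
  transitivity ((v *m A) 0 (Ordinal kM)); last by rewrite vA0 mxE.
  rewrite mxE; apply: eq_bigr => i _; by rewrite coefZ mxE.
(* The nodes 1, ..., M are distinct and nonzero. *)
pose t : 'rV[K]_M := \row_k k.+1%:R.
have Vu : Vandermonde M t \in unitmx.
  rewrite unitmxE det_Vandermonde unitfE; apply/prodf_neq0 => i _.
  apply/prodf_neq0 => j ij; rewrite !mxE subr_eq0 eqr_nat eqSS neq_ltn.
  by rewrite ij orbT.
have Bfull : row_full (A *m Vandermonde M t)^T.
  rewrite -[X in row_full X]mul1mx /row_full mul1mx mxrank_tr mxrankMfree //.
  by rewrite row_free_unit.
pose f := fullrankfun Bfull; exists (fun i => t 0 (f i)); split=> [i|].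
  by rewrite mxE pnatr_eq0.
rewrite -unitfE -unitmxE -unitmx_tr.
rewrite (_ : _^T = rowsub f (A *m Vandermonde M t)^T).
  exact: fullrowsub_unit.
apply/matrixP => i j; rewrite !mxE (horner_coef_wide _ (aM j)).
by apply: eq_bigr => k _; rewrite !mxE.
Qed.

(* If f vanishes on all the sums, then differentiating with respect to the
   parameters and inverting the Jacobian matrix shows that so do its partial
   derivatives. *)
Lemma curve_sums_dense g (alpha : 'I_g -> {poly K}) :
  (exists p : 'I_g -> K, \det (\matrix_(j, i) (alpha j)^`().[p i]) != 0) ->
  forall f : mpoly g K,
    (forall p : 'I_g -> K, meval (fun j => \sum_i (alpha j).[p i]) f = 0) -> f = 0.
Proof.
move=> jac; apply: mderiv_ind0 => [f j f0|c /(_ (fun=> 0))]; last by rewrite mevalC.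
pose F j (p : 'I_g -> K) := meval (fun j => \sum_i (alpha j).[p i]) (mderiv j f).
pose J (p : 'I_g -> K) := \det (\matrix_(j, i) (alpha j)^`().[p i]).
have FJ0 j' p : F j' p * J p = 0.
  have FM0 : (\row_j F j p) *m (\matrix_(j, i) (alpha j)^`().[p i]) = 0.
    apply/rowP => i; rewrite !mxE.
    (* Only the i-th parameter moves; the chain rule at [p i] gives the i-th entry. *)
    pose h j : {poly K} := (\sum_(k | k != i) (alpha j).[p k])%:P + alpha j.
    have h0 : mmap polyC h f = 0.
      apply: poly_eq0 => s; rewrite horner_mmap -[RHS](f0 (update p i s)).
      apply: meval_eq => k; rewrite /h hornerD hornerC [RHS](bigD1 i) //= addrC.
      rewrite /update eqxx; congr (_ + _); apply: eq_bigr => l li.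
      by rewrite (negPf li).
    have := deriv_mmap h f; rewrite h0 deriv0 => /(congr1 (fun q => q.[p i])).
    rewrite horner0 horner_sum => e; rewrite [RHS]e.
    apply: eq_bigr => k _; rewrite !mxE hornerM /h derivD derivC add0r.
    rewrite horner_mmap; congr (_ * _); apply: meval_eq => l.
    by rewrite hornerD hornerC [LHS](bigD1 i) //= addrC.
  (* The adjugate avoids division, so the conclusion holds at every p, even where the Jacobian
     vanishes. *)
  move/(congr1 (fun B => (B *m \adj (\matrix_(j, i) (alpha j)^`().[p i])) 0 j')): FM0.
  by rewrite -mulmxA mul_mx_adj mul_mx_scalar mul0mx !mxE mulrC.
apply: (@polyfunM_eq0 K g (F j) J _ _ (FJ0 j)) => //.
  by apply: polyfun_meval => k; apply: polyfun_sum => i _;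
    apply: polyfun_horner; exact: polyfun_var.
rewrite /J; apply: polyfun_det => k i; apply: polyfun_horner; exact: polyfun_var.
Qed.

End CharacteristicZero.

(** * The Nullstellensatz for a hypersurface *)

Section Nullstellensatz.

Variable K : numClosedFieldType.

(** Over a closed field p splits into deg p linear factors, each of which divides q. *)
Lemma dvdp_exp_roots (p q : {poly K}) : p != 0 ->
  (forall s, root p s -> root q s) -> p %| q ^+ (size p).-1.
Proof.
move=> pn0 pq; have [r pE] := closed_field_poly_normal p.
have {}pq : all (root q) r.
  apply/allP => s sr; apply: pq; rewrite pE rootZ ?lead_coef_eq0 //.
  by rewrite root_prod_XsubC.
have -> : (size p).-1 = size r.
  by rewrite pE size_scale ?lead_coef_eq0 // size_prod_XsubC.
rewrite pE dvdpZl ?lead_coef_eq0 //; elim: r pq {pE} => [|s r IH] /=.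
  by rewrite big_nil dvd1p.
by case/andP=> qs qr; rewrite big_cons exprS dvdp_mul ?IH // dvdp_XsubCl.
Qed.

Section Shift.

Variables (n : nat) (v : 'I_n -> K).

(** The coordinates of z + s v, with s the outer variable; [shift p] is then p(z + s v) as a
    polynomial in s. *)
Definition shift_var (i : 'I_n) : {poly mpoly n K} :=
  (mpolyX K (mnm1 i))%:P + (mpolyC n (v i))%:P * 'X.

Fact shift_key : unit. Proof. by []. Qed.
Definition shift (p : mpoly n K) : {poly mpoly n K} :=
  locked_with shift_key (mmap (polyC \o @mpolyC n K) shift_var p).

Lemma shiftE p : shift p = mmap (polyC \o @mpolyC n K) shift_var p.
Proof. by rewrite /shift unlock. Qed.

Lemma shift_horner0 p : (shift p).[0] = p.
Proof.
rewrite shiftE /mmap horner_sum [RHS]mpolyE; apply: eq_bigr => m _.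
rewrite hornerM /= hornerC mul_mpolyC; congr (_ *: _).
rewrite mpolyXE_id /mmap1 horner_prod; apply: eq_bigr => i _.
by rewrite horner_exp /shift_var hornerD hornerM hornerX !hornerC mulr0 addr0.
Qed.

Lemma shift_eval p x s :
  (map_poly (meval x) (shift p)).[s] = meval (fun i => x i + v i * s) p.
Proof.
rewrite shiftE /mmap rmorph_sum horner_sum mevalE; apply: eq_bigr => m _.
rewrite rmorphM hornerM /= map_polyC /= hornerC mevalC; congr (_ * _).
rewrite /mmap1 rmorph_prod horner_prod; apply: eq_bigr => i _.
rewrite rmorphXn horner_exp /shift_var /= rmorphD rmorphM /= !map_polyC map_polyX /=.
by rewrite hornerD hornerM hornerX !hornerC mevalC mevalXU.
Qed.

(** The constant c may be 0, as when some [v i] is 0, so d only bounds the degree. *)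
Let lead_at d c (p : {poly mpoly n K}) := (size p <= d.+1)%N /\ p`_d = mpolyC n c.

Let lead_atM d e b c p q :
  lead_at d b p -> lead_at e c q -> lead_at (d + e) (b * c) (p * q).
Proof.
move=> [ps pd] [qs qe]; split.
  apply: leq_trans (size_polyMleq _ _) _; rewrite -ltnS.
  by apply: leq_trans (leqSpred _) _; rewrite ltnS; lia.
rewrite coefM; have dde : (d < (d + e).+1)%N by lia.
rewrite (bigD1 (Ordinal dde)) //= addKn pd qe -mpolyCM big1 ?addr0 // => i id.
have [di|] := ltnP d i; first by rewrite nth_default ?mul0r // (leq_trans ps).
rewrite leq_eqVlt => /orP[/eqP ed|di].
  by case/eqP: id; apply/val_inj.
by rewrite [q`__]nth_default ?mulr0 // (leq_trans qs) //; lia.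
Qed.

Let lead_mmap1 m : lead_at (mdeg m) (\prod_i v i ^+ m i) (mmap1 shift_var m).
Proof.
rewrite mdegE /mmap1; elim/big_rec3: _ => [|i y d q _ H].
  by split; [rewrite size_polyC oner_eq0|rewrite coefC].
apply: lead_atM => //; elim: (m i) => [|k IH].
  by rewrite !expr0; split; [rewrite size_polyC oner_eq0|rewrite coefC].
rewrite !exprS -add1n; apply: lead_atM => //; split.
  rewrite /shift_var; apply: leq_trans (size_polyD _ _) _.
  rewrite geq_max (leq_trans (size_polyC_leq1 _)) //.
  by apply: leq_trans (size_polyMleq _ _) _; rewrite size_polyX addn2 ltnS size_polyC_leq1.
by rewrite /shift_var coefD coefC coefMX coefC add0r.
Qed.

Lemma size_shift p : (size (shift p) <= mmeasure (@mdeg n) p)%N.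
Proof.
rewrite shiftE /mmap; apply: (leq_trans (size_sum _ _ _)).
rewrite big_seq; apply/bigmax_leqP_seq => m mp; rewrite mp => _.
have [s _] := lead_mmap1 m; rewrite /= mul_polyC.
by apply: leq_trans (size_scale_leq _ _) (leq_trans s _); exact: msize_mdeg_lt.
Qed.

(** Only the homogeneous part of top degree reaches s^d, and it does so through its value at v. The
    coefficient is therefore free of z. *)
Lemma coef_shift p d : mmeasure (@mdeg n) p = d.+1 ->
  (shift p)`_d = mpolyC n (\sum_(m <- msupp p | mdeg m == d)
                             mcoeff m p * \prod_i v i ^+ m i).
Proof.
move=> pd; rewrite shiftE /mmap coef_sum [in RHS]big_mkcond rmorph_sum.
rewrite big_seq [RHS]big_seq; apply: eq_bigr => m mp; rewrite /= coefCM.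
have [s c] := lead_mmap1 m; case: ifPn => [/eqP <-|md].
  by rewrite c -mpolyCM.
rewrite nth_default ?mulr0 ?mpolyC0 // (leq_trans s) //.
by have := msize_mdeg_lt mp; rewrite pd ltnS leq_eqVlt (negPf md).
Qed.

End Shift.

(** Any v at which the top homogeneous part of p does not vanish works, since the leading
    coefficient in s is then a nonzero constant. *)
Lemma exists_monic_direction n (p : mpoly n K) : p != 0 ->
  exists v c, c != 0 /\ (mpolyC n c)%:P * shift v p \is monic.
Proof.
move=> pn0; have := pn0; rewrite -(mmeasure_poly_eq0 (@mdeg n)) -lt0n.
case pd: (mmeasure (@mdeg n) p) => [//|d] _.
pose top := \sum_(m <- msupp p | mdeg m == d) mcoeff m p *: mpolyX K m.
have topn0 : top != 0.
  have [m mp md] : exists2 m, m \in msupp p & mdeg m = d.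
    apply: contrapT => nm.
    suff: (mmeasure (@mdeg n) p <= d)%N by rewrite pd ltnn.
    rewrite mmeasureE big_seq; apply/bigmax_leqP_seq => m mp' mp.
    have := msize_mdeg_lt mp; rewrite pd ltnS leq_eqVlt => /orP[/eqP md|//].
    by case: nm; exists m.
  apply: contraTneq mp => top0; rewrite mcoeff_msupp negbK.
  have := congr1 (mcoeff m) top0; rewrite mcoeff0 /top raddf_sum /=.
  have [mp|/memN_msupp_eq0 -> //] := boolP (m \in msupp p).
  rewrite big_mkcond (bigD1_seq m) ?msupp_uniq //= md eqxx.
  rewrite mcoeffZ mcoeffX eqxx mulr1 big1 ?addr0 => [->//|m' m'm].
  by case: ifP => // _; rewrite mcoeffZ mcoeffX (negPf m'm) mulr0.
have [v vtop] : exists v, meval v top != 0.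
  apply: contrapT => nv; case/eqP: topn0; apply: meval_eq0 => v.
  by apply/eqP/contraT => tv; case: nv; exists v.
have sd : (shift v p)`_d = mpolyC n (meval v top).
  rewrite (coef_shift _ pd); congr (mpolyC n _); rewrite /top rmorph_sum /=.
  by apply: eq_bigr => m _; rewrite mevalZ mevalX.
have sz : size (shift v p) = d.+1.
  apply/eqP; rewrite eqn_leq -{1}pd size_shift /=.
  rewrite ltnNge; apply/negP => /leq_sizeP/(_ d (leqnn d))/eqP.
  by rewrite sd mpolyC_eq0 (negPf vtop).
exists v, (meval v top)^-1; split; first by rewrite invr_neq0.
have lc : (mpolyC n (meval v top)^-1) * lead_coef (shift v p) = 1.
  by rewrite lead_coefE sz /= sd -mpolyCM mulVf.
by rewrite monicE mul_polyC lead_coefZ // lc.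
Qed.

(* Divide q(z + s v) ^ d by p(z + s v), made monic in s: the remainder vanishes
   on every line z + K v, because there p has d roots, all of them roots of q. *)
Lemma hypersurface_nullstellensatz n (p q : mpoly n K) : p != 0 ->
  (forall x, meval x p = 0 -> meval x q = 0) ->
  exists d r, q ^+ d = r * p.
Proof.
move=> pn0 pq; have [v [c [cn0 mon]]] := exists_monic_direction pn0.
(* Being monic, P keeps its degree under every specialization of z, so one exponent serves all
   lines. *)
set P := _ * _ in mon; pose d := (size P).-1; exists d.
pose Q := shift v q ^+ d.
have QE := Pdiv.RingMonic.rdivp_eq mon Q; set r := Pdiv.Ring.rmodp Q P in QE.
have evr0 (x : 'I_n -> K) : map_poly (meval x) r = 0.
  pose ev := map_poly (meval x).
  have Pev : size (ev P) = size P.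
    by rewrite size_map_poly_id0 // (monicP mon) meval1 oner_eq0.
  have Pn0 : ev P != 0 by rewrite -size_poly_eq0 Pev size_poly_eq0 monic_neq0.
  have Pr : ev P %| ev r.
    have -> : ev r = ev Q - ev (Pdiv.Ring.rdivp Q P) * ev P.
      by rewrite -rmorphM -rmorphB /= {1}QE addrAC subrr add0r.
    rewrite dvdp_sub ?dvdp_mull // /ev rmorphXn /= /d -Pev.
    apply: dvdp_exp_roots => // s; rewrite !rootE /ev rmorphM hornerM /=.
    rewrite map_polyC hornerC /= mevalC mulf_eq0 (negPf cn0) /=.
    by rewrite [X in X == 0 -> _]shift_eval [X in _ -> X == 0]shift_eval => /eqP/pq/eqP.
  apply/eqP; apply: contraTT Pr => rn0; apply/negP => /dvdp_leq -/(_ rn0).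
  rewrite leqNgt => /negP; apply; rewrite Pev.
  by apply: leq_ltn_trans (size_poly _ _) _; rewrite Pdiv.Ring.ltn_rmodpN0 // monic_neq0.
have r0 : r = 0.
  apply/polyP => k; rewrite coef0; apply: meval_eq0 => x.
  by have := congr1 (fun p : {poly K} => p`_k) (evr0 x); rewrite coef_map coef0.
(* At s = 0 the exact division becomes the required identity. *)
exists ((Pdiv.Ring.rdivp Q P).[0] * mpolyC n c).
have := congr1 (fun p => p.[0]) QE; rewrite r0 addr0 /Q horner_exp shift_horner0 => ->.
by rewrite hornerM /P hornerM hornerC shift_horner0 mulrA.
Qed.

End Nullstellensatz.

(** * Coefficients of the exponential *)

Section ExponentialCoefficients.

Variable R : realType.
Local Notation K := R[i].

(* [sg] is locked so that failing conversion tests do not unfold the sums. *)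
Fact sg_key : unit. Proof. by []. Qed.
Definition sg (x : nat -> K) (n : nat) : K := locked_with sg_key (@sigma R K^o x n).
Definition sgz (x : nat -> K) (l : int) : K := if l is Posz n then sg x n else 0.

Lemma sgE x n : sg x n = @sigma R K^o x n.
Proof. by rewrite /sg unlock. Qed.

Lemma sgzE x l : sgz x l = @sigmaz R K^o x l.
Proof. by case: l => n //=; rewrite sgE. Qed.

Definition eqmodX (N : nat) (P Q : {poly K}) := forall i, (i < N)%N -> P`_i = Q`_i.

Lemma eqmodXM N P P' Q Q' :
  eqmodX N P P' -> eqmodX N Q Q' -> eqmodX N (P * Q) (P' * Q').
Proof.
move=> PP' QQ' i iN; rewrite !coefM; apply: eq_bigr => j _.
by rewrite PP' ?QQ' //; case: j => j /=; lia.
Qed.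

Lemma eqmodX_exp N P Q k : eqmodX N P Q -> eqmodX N (P ^+ k) (Q ^+ k).
Proof.
move=> PQ; elim: k => [|k IH]; first by rewrite !expr0.
by rewrite !exprS; apply: eqmodXM.
Qed.

Definition xpol (x : nat -> K) N : {poly K} :=
  \poly_(i < N.+1) (if i is i'.+1 then x i' else 0).

Definition texp N (P : {poly K}) : {poly K} := \sum_(k < N.+1) (k`!%:R)^-1 *: P ^+ k.

Lemma coef_exp_lt (P : {poly K}) k i : P`_0 = 0 -> (i < k)%N -> (P ^+ k)`_i = 0.
Proof.
move=> P0; elim: k i => [//|k IH] i ik; rewrite exprS coefM big1 // => -[[|j] ji] _ /=.
  by rewrite P0 mul0r.
by rewrite IH ?mulr0 //; lia.
Qed.

(** As P has no constant term, P^k with k > n does not reach t^n. The coefficient depends neither on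
    N nor on the terms of P beyond t^n. *)
Lemma coef_texp N (P : {poly K}) x n : P`_0 = 0 ->
  (forall i, (i < n)%N -> P`_i.+1 = x i) -> (n <= N)%N -> (texp N P)`_n = sg x n.
Proof.
move=> P0 Px nN; rewrite /texp coef_sum.
transitivity (\sum_(k < n.+1) (k`!%:R)^-1 * (xpol x n ^+ k)`_n); last by rewrite sgE.
rewrite (big_ord_widen _ (fun k => (k`!%:R)^-1 * (xpol x n ^+ k)`_n) (_ : n.+1 <= N.+1)%N) //.
rewrite [RHS]big_mkcond; apply: eq_bigr => k _; rewrite coefZ.
case: ifPn => [_|]; last by rewrite -leqNgt => nk; rewrite coef_exp_lt ?mulr0.
congr (_ * _); apply: (@eqmodX_exp n.+1) => // -[|i] ilt; rewrite coef_poly ilt //.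
by rewrite Px.
Qed.

Lemma xpol0 x N : (xpol x N)`_0 = 0.
Proof. by rewrite coef_poly. Qed.

Lemma xpolS x N i : (i < N)%N -> (xpol x N)`_i.+1 = x i.
Proof. by move=> iN; rewrite coef_poly ltnS iN. Qed.

Lemma sg0 x : sg x 0 = 1.
Proof.
rewrite -(@coef_texp 0 0) ?coef0 // /texp big_ord1 expr0 coefZ coef1.
by rewrite mulr1 invr1.
Qed.

Lemma deriv_texp N (P : {poly K}) : (texp N.+1 P)^`() = P^`() * texp N P.
Proof.
rewrite /texp raddf_sum /= big_ord_recl derivZ expr0 derivC scaler0 add0r.
rewrite mulr_sumr; apply: eq_bigr => k _; rewrite derivZ /= /bump /= add1n.
rewrite deriv_exp /= -scalerAr -[_ * _ *+ _]scaler_nat scalerA.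
congr (_ *: _); rewrite factS natrM invfM mulrAC mulVf ?mul1r //.
Qed.

(** This is the coefficient of t^n in E' = P' E, where E = exp P. *)
Lemma sgS (x : nat -> K) n :
  n.+1%:R * sg x n.+1 = \sum_(i < n.+1) i.+1%:R * x i * sg x (n - i).
Proof.
have xs m : (m <= n.+1)%N -> forall i, (i < m)%N -> (xpol x n.+1)`_i.+1 = x i.
  by move=> mn i im; rewrite xpolS // (leq_trans im).
rewrite -(@coef_texp n.+1 (xpol x n.+1)) ?xpol0 //; last exact: xs.
rewrite mulr_natl -coef_deriv deriv_texp coefM; apply: eq_bigr => i _.
rewrite coef_deriv xpolS ?ltn_ord // mulr_natl.
by rewrite (@coef_texp _ _ x) ?leq_subr ?xpol0 //; apply: xs; lia.
Qed.

(** The recursion characterizes the exponential; the product formula and the values at [pt p] are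
    obtained by checking it. *)
Lemma sg_uniq (x e : nat -> K) : e 0%N = 1 ->
  (forall n, n.+1%:R * e n.+1 = \sum_(i < n.+1) i.+1%:R * x i * e (n - i)%N) ->
  forall n, e n = sg x n.
Proof.
move=> e0 eS n; have [m] := ubnP n; elim: m n => // m IH [|n] nm.
  by rewrite e0 sg0.
apply: (@mulfI _ n.+1%:R); first by rewrite pnatr_eq0.
rewrite eS sgS; apply: eq_bigr => i _; congr (_ * _); apply: IH.
by move: nm; rewrite ltnS; apply: leq_ltn_trans; rewrite leq_subr.
Qed.

(** By the product rule, the product of the two exponentials satisfies the differential equation of
    the exponential of the sum. *)
Lemma sgD (x y : nat -> K) n : sg (x \+ y) n = \sum_(i < n.+1) sg x i * sg y (n - i).
Proof.
pose e n := \sum_(i < n.+1) sg x i * sg y (n - i).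
rewrite -[RHS]/(e n); apply/esym/sg_uniq => {n} [|n].
  by rewrite /e big_ord1 !sg0 mulr1.
have [S SE] : exists S : (nat -> K) -> {poly K},
    forall x' i, (i < n.+2)%N -> (S x')`_i = sg x' i.
  by exists (fun x' => \poly_(i < n.+2) sg x' i) => x' i h; rewrite coef_poly h.
have eE m : (m < n.+2)%N -> e m = (S x * S y)`_m.
  move=> mn; rewrite coefM /e; apply: eq_bigr => i _; have im := ltn_ord i.
  have im1 : (i < n.+2)%N by lia.
  have im2 : (m - i < n.+2)%N by lia.
  by rewrite (SE x _ im1) (SE y _ im2).
have dS x' : eqmodX n.+1 (S x')^`() ((xpol x' n.+1)^`() * S x').
  move=> i ilt; rewrite coef_deriv SE // -mulr_natl sgS coefM.
  apply: eq_bigr => j _; have jlt := ltn_ord j.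
  rewrite coef_deriv xpolS; last by lia.
  have ji : (i - j < n.+2)%N by lia.
  by rewrite (SE _ _ ji) mulr_natl.
rewrite eE // mulr_natl -coef_deriv derivM coefD.
rewrite (@eqmodXM n.+1 _ _ _ _ (dS x) (fun _ _ => erefl)) //.
rewrite (@eqmodXM n.+1 _ _ _ _ (fun _ _ => erefl) (dS y)) //.
rewrite -coefD mulrCA -mulrA -mulrDl -derivD coefM.
apply: eq_bigr => i _; rewrite coef_deriv coefD !xpolS ?ltn_ord //.
by rewrite mulr_natl eE //; lia.
Qed.

(* The coordinates x_i = p^i / i turn exp (\sum_i x_i t^i) into 1 / (1 - p t). *)
Definition pt (p : K) (i : nat) : K := p ^+ i.+1 / i.+1%:R.

Lemma sg_pt p n : sg (pt p) n = p ^+ n.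
Proof.
apply/esym/sg_uniq => {n} [|n]; first by rewrite expr0.
transitivity (\sum_(i < n.+1) p ^+ n.+1).
  by rewrite sumr_const card_ord mulr_natl.
apply: eq_bigr => i _; rewrite /pt mulrCA divff ?pnatr_eq0 // mulr1 -exprD.
by congr (_ ^+ _); have := ltn_ord i; lia.
Qed.

Lemma sgz_pt p (n : nat) : sgz (pt p) n = p ^+ n.
Proof. exact: sg_pt. Qed.

Lemma sgz0 (l : int) : sgz (fun=> 0) l = (l == 0)%:R.
Proof.
case: l => [[|n]|n] //; first exact: sg0.
apply: (@mulfI _ n.+1%:R); first by rewrite pnatr_eq0.
rewrite mulr0 -[sgz _ _]/(sg (fun=> 0) n.+1) sgS big1 // => i _.
by rewrite mulr0 mul0r.
Qed.

(** Adding [pt p] divides the exponential by 1 - p t; the left side multiplies it back. *)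
Lemma sgz_addpt (x : nat -> K) p l : sgz (x \+ pt p) l - p * sgz (x \+ pt p) (l - 1) = sgz x l.
Proof.
case: l => [[|n]|n]; last by rewrite mulr0 subr0.
  by rewrite mulr0 subr0 -[LHS]/(sg _ 0) -[RHS]/(sg _ 0) !sg0.
have -> : n.+1%:Z - 1 = n by lia.
rewrite -[sgz _ n]/(sg _ n) -[sgz _ _]/(sg _ n.+1) -[RHS]/(sg x n.+1) !sgD.
rewrite big_ord_recr /= subnn sg0 mulr1 mulr_sumr addrAC -sumrB big1 ?add0r // => i _.
by rewrite !sg_pt subSn -1?ltnS // exprS; ring.
Qed.

(** The [b m] are the coefficients of the product of the 1 - p t, hence independent of x and l. *)
Lemma sgz_addpts (s : seq K) : exists b : nat -> K, b 0%N = 1 /\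
  forall x l, \sum_(m < (size s).+1) b m * sgz (fun i => x i + \sum_(p <- s) pt p i) (l - m%:Z)
              = sgz x l.
Proof.
elim: s => [|p s [b [b0 bE]]].
  exists (fun=> 1); split=> // x l.
  have -> : (fun i => x i + \sum_(p <- [::]) pt p i) = x.
    by apply/funext => i; rewrite big_nil addr0.
  rewrite big_ord1 mul1r; congr (sgz x _); exact: subr0.
(* Multiplication by 1 - p t. The cut at [size s] is needed because b is unconstrained beyond it. *)
exists (fun m => (if (m <= size s)%N then b m else 0) -
                 (if m is m'.+1 then p * b m' else 0)); split=> [|x l].
  by rewrite b0 subr0.
rewrite /= -(sgz_addpt x p) -!bE.
have -> : (fun i => x i + \sum_(q <- p :: s) pt q i) =
          (fun i => (x \+ pt p) i + \sum_(q <- s) pt q i).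
  by apply/funext => i; rewrite big_cons addrA.
set X := fun _ => _; under eq_bigr do rewrite mulrBl.
rewrite sumrB; congr (_ - _).
  rewrite big_ord_recr /= ltnn mul0r addr0; apply: eq_bigr => m _.
  by rewrite -ltnS ltn_ord.
rewrite big_ord_recl /= mul0r add0r mulr_sumr; apply: eq_bigr => m _.
by rewrite /bump /= add1n mulrA; congr (_ * sgz _ _); lia.
Qed.

End ExponentialCoefficients.

(** * Tau as a determinant *)

Section CauchyBinet.

Variables (A : comRingType) (g M : nat).

(** A choice of g columns, listed in the order of the strictly decreasing sequences λ_i - i attached
    to partitions. *)
Definition decreasing (k : {ffun 'I_g -> 'I_M}) : bool :=
  [forall i : 'I_g, forall j : 'I_g, (i < j)%N ==> (k j < k i)%N].

Lemma decreasingP (k : {ffun 'I_g -> 'I_M}) :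
  reflect (forall i j : 'I_g, (i < j)%N -> (k j < k i)%N) (decreasing k).
Proof.
apply: (iffP forallP) => [H i j ij|H i].
  by have /forallP/(_ j)/implyP/(_ ij) := H i.
by apply/forallP => j; apply/implyP; exact: H.
Qed.

Let perm_ffun (p : {ffun 'I_g -> 'I_M} * 'S_g) : {ffun 'I_g -> 'I_M} :=
  [ffun i => p.1 (p.2 i)].

Let decreasing_lt (k : {ffun 'I_g -> 'I_M}) (i j : 'I_g) : decreasing k -> (k i < k j)%N = (j < i)%N.
Proof.
move=> /decreasingP kd; case: (ltngtP j i) => [ji|ij|/val_inj ->].
- exact: kd.
- by apply/negbTE; rewrite -leqNgt ltnW // kd.
- by rewrite ltnn.
Qed.

(** For injective f, the position of [f i] among the values in decreasing order; it recovers the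
    sorting permutation. *)
Let rank (f : {ffun 'I_g -> 'I_M}) (i : 'I_g) : nat := #|[pred j | (f i < f j)%N]|.

Let rank_lt f i : (rank f i < g)%N.
Proof.
rewrite -[X in (_ < X)%N](card_ord g) -(cardC [pred j | (f i < f j)%N]).
rewrite -[X in (X < _)%N]addn0 ltn_add2l; apply/card_gt0P; exists i.
by rewrite !inE ltnn.
Qed.

Let rank_mono (f : {ffun 'I_g -> 'I_M}) i j : (f i < f j)%N -> (rank f j < rank f i)%N.
Proof.
move=> ij; apply: proper_card; apply/properP; split.
  by apply/fintype.subsetP => l; rewrite !inE; apply: ltn_trans.
by exists j; rewrite !inE ?ij ?ltnn.
Qed.

Let rank_perm_ffun k (s : 'S_g) i : decreasing k -> rank (perm_ffun (k, s)) i = s i.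
Proof.
move=> kd; rewrite /rank -sum1_card.
transitivity (\sum_(j < g | (s j < s i)%N) 1)%N.
  by apply: eq_bigl => j; rewrite !inE !ffunE /= decreasing_lt.
transitivity (\sum_(j < g | (j < s i)%N) 1)%N; last first.
  by rewrite -(big_ord_widen _ (fun=> 1%N)) ?sum1_card ?card_ord // ltnW.
by rewrite [RHS](reindex_perm s).
Qed.

Let perm_ffun_inj k k' s s' : decreasing k -> decreasing k' ->
  perm_ffun (k, s) = perm_ffun (k', s') -> (k, s) = (k', s').
Proof.
move=> kd kd' e; have ss' : s = s'.
  by apply/permP => i; apply/val_inj; rewrite /= -(rank_perm_ffun s i kd) e rank_perm_ffun.
congr pair => //; apply/ffunP => i.
have := congr1 (fun f : {ffun 'I_g -> 'I_M} => f (s^-1%g i)) e.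
by rewrite !ffunE /= -ss' permKV.
Qed.

Let perm_ffun_surj (f : {ffun 'I_g -> 'I_M}) : injectiveb f ->
  exists p, decreasing p.1 && (perm_ffun p == f).
Proof.
move=> /injectiveP finj; pose r i := Ordinal (rank_lt f i).
have rinj : injective r.
  move=> i j /(congr1 val) /= rij; apply: finj; apply/val_inj.
  by case: (ltngtP (f i) (f j)) => // /rank_mono; rewrite rij ltnn.
exists ([ffun i => f ((perm rinj)^-1%g i)], perm rinj); apply/andP; split.
  apply/decreasingP => i j ij; rewrite !ffunE /=.
  set i' := (perm rinj)^-1%g i; set j' := (perm rinj)^-1%g j.
  have iE : i = r i' by rewrite /i' -{1}(permKV (perm rinj) i) permE.
  have jE : j = r j' by rewrite /j' -{1}(permKV (perm rinj) j) permE.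
  have rij : (rank f i' < rank f j')%N by move: ij; rewrite iE jE.
  case: (ltngtP (f j') (f i')) => // [/rank_mono|/val_inj/finj e].
    by rewrite ltnNge ltnW.
  by move: rij; rewrite e ltnn.
by apply/eqP/ffunP => i; rewrite !ffunE /= permK.
Qed.

(** Cauchy-Binet: expand over all maps f. Those that are not injective repeat a row, and the others
    are uniquely a decreasing map composed with a permutation. *)
Lemma det_mulmx_decreasing (X : 'M[A]_(g, M)) (Y : 'M[A]_(M, g)) :
  \det (X *m Y) =
  \sum_(k : {ffun 'I_g -> 'I_M} | decreasing k) \det (colsub k X) * \det (rowsub k Y).
Proof.
transitivity (\sum_(f : {ffun 'I_g -> 'I_M}) (\prod_i X i (f i)) * \det (rowsub f Y)).
  rewrite /determinant.
  under eq_bigr => s _.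
    under eq_bigr do rewrite mxE.
    rewrite bigA_distr_bigA /= big_distrr /=.
    over.
  rewrite exchange_big /=; apply: eq_bigr => f _; rewrite big_distrr /=.
  apply: eq_bigr => s _; rewrite big_split /= mulrCA; congr (_ * (_ * _)).
  by apply: eq_bigr => i _; rewrite mxE.
rewrite (bigID (fun f : {ffun 'I_g -> 'I_M} => injectiveb f)) /=.
rewrite [X in _ + X]big1 ?addr0 => [|f]; last first.
  move/injectivePn => [i [j ij fij]]; rewrite (determinant_alternate ij) ?mulr0 // => l.
  by rewrite !mxE fij.
(* On injective f the search succeeds, so the default is never returned there. *)
pose inv (f : {ffun 'I_g -> 'I_M}) : {ffun 'I_g -> 'I_M} * 'S_g := odflt (f, 1%g)
  [pick p : {ffun 'I_g -> 'I_M} * 'S_g | decreasing p.1 && (perm_ffun p == f)].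
have invK (f : {ffun 'I_g -> 'I_M}) : injectiveb f -> decreasing (inv f).1 /\ perm_ffun (inv f) = f.
  move=> /perm_ffun_surj [p pf]; rewrite /inv; case: pickP => [q /andP[qd /eqP //]|] /=.
  by move/(_ p); rewrite pf.
rewrite (reindex_onto perm_ffun inv) => [|f /invK[] //].
rewrite (eq_bigl (fun p => decreasing p.1)) => [|[k s]]; last first.
  have [kd|kd] := boolP (decreasing k); last first.
    apply/negP => /andP[fi /eqP e]; have [] := invK _ fi.
    by rewrite e (negPf kd).
  have inj : injectiveb (perm_ffun (k, s)).
    apply/injectiveP => i j; rewrite !ffunE /= => e; apply: (@perm_inj _ s).
    apply/val_inj; case: (ltngtP (s i) (s j)) => // /(decreasingP _ kd).
      by rewrite e ltnn.
    by rewrite e ltnn.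
  rewrite inj /=; apply/eqP; have [] := invK _ inj.
  case: (inv _) => k' s' /= kd' e; exact: perm_ffun_inj e.
transitivity (\sum_(k : {ffun 'I_g -> 'I_M} | decreasing k) \sum_(s : 'S_g)
    (\prod_i X i (perm_ffun (k, s) i)) * \det (rowsub (perm_ffun (k, s)) Y)).
  by rewrite pair_big /=; apply: eq_big => [[k s]|[k s] _] //=; rewrite andbT.
apply: eq_bigr => k _; rewrite /(\det (colsub k X)) big_distrl /=.
apply: eq_bigr => s _.
rewrite (_ : rowsub _ Y = row_perm s (rowsub k Y)); last first.
  by apply/matrixP => i j; rewrite !mxE ffunE.
rewrite row_permE det_mulmx det_perm mulrCA mulrA; congr (_ * _ * _).
by apply: eq_bigr => i _; rewrite !mxE ffunE.
Qed.

End CauchyBinet.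

(** * The tau function of the curve as a determinant of size g *)

Section TauDeterminant.

Variables (R : realType) (g : nat) (a : 'I_g -> {poly R[i]}).

(** The shifts run from 2 - g to 1. The algebra is arbitrary, so that x may be formal variables,
    polynomials or numbers. *)
Definition tau_mx (A : comAlgType R[i]) (x : nat -> A) : 'M[A]_g :=
  \matrix_(j < g, l < g)
    \sum_(k < size (a j)) (a j)`_k *: sigmaz x (k%:Z + (l%:Z + 2 - g%:Z)).

Definition tau_det (A : comAlgType R[i]) (x : nat -> A) : A := \det (tau_mx x).

(** The frame matrix in natural number indices. Subtraction truncates, hence the separate test for a
    negative exponent of u. *)
Let ent (l : seq nat) (i j : nat) : R[i] :=
  if (insub j : option 'I_g) is Some j' then
    if (i.+1 < nth 0%N l i + g)%N then (a j')`_(nth 0%N l i + g - i.+2) else 0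
  else (i == nth 0%N l i + j)%N%:R.

Let xi_ent l i j : xi (curve_frame a) ((nth 0%N l i)%:Z - i.+1%:Z) j = ent l i j.
Proof.
rewrite curve_frame_xi /omega_seq /ent; case: insubP => [j' _ _|jg].
  rewrite /laurent_of_poly; case: ltnP => il.
    by have -> : (nth 0%N l i)%:Z - i.+1%:Z + g%:Z - 1 = (nth 0%N l i + g - i.+2)%N by lia.
  have: (nth 0%N l i)%:Z - i.+1%:Z + g%:Z - 1 < 0 by lia.
  by case: (_ - 1 : int).
by rewrite /monomial; congr (_%:R); apply/eqP/eqP; lia.
Qed.

(** Past the end of l, and from row g on, a row has a single nonzero entry, the 1 on the
    diagonal. *)
Let det_entS l N : (g <= N)%N -> (size l <= N)%N ->
  \det (\matrix_(i < N.+1, j < N.+1) ent l i j) = \det (\matrix_(i < N, j < N) ent l i j).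
Proof.
move=> gN lN; rewrite (expand_det_row _ ord_max) (bigD1 ord_max) //= big1 => [|j jN].
  rewrite addr0 mxE /ent insubN -?leqNgt //= nth_default // add0n eqxx mul1r.
  rewrite /cofactor addnn -signr_odd odd_double expr0 mul1r; congr (\det _).
  by apply/matrixP => i j; rewrite !mxE !lift_max.
rewrite mxE /ent /= nth_default // add0n; case: insubP => [j' _ _|_].
  by case: ifPn => [|_]; rewrite ?mul0r // ltnNge ltnW // ltnS.
case: eqP => [Nj|_]; last by rewrite mul0r.
by case/eqP: jN; apply/val_inj.
Qed.

Let det_ent_stable l N : (g <= N)%N -> (size l <= N)%N -> forall M, (N <= M)%N ->
  \det (\matrix_(i < M, j < M) ent l i j) = \det (\matrix_(i < N, j < N) ent l i j).
Proof.
move=> gN lN M /subnK <-; elim: (M - N)%N => // k IH.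
by rewrite addSn det_entS ?IH //; lia.
Qed.

(* If l has more than g parts, the first g + 1 rows vanish outside of the first
   g columns. *)
Let det_ent_long l N : is_partition l -> (g < size l)%N -> (size l <= N)%N ->
  \det (\matrix_(i < N, j < N) ent l i j) = 0.
Proof.
move=> /andP[_ l0] gl lN; rewrite /determinant big1 // => s _.
suff [i ig sig] : exists2 i : 'I_N, (i <= g)%N & (g <= s i)%N.
  rewrite (bigD1 i) //= mxE /ent insubN -?leqNgt //.
  case: eqP => [e|_]; last by rewrite mul0r mulr0.
  have li : (0 < nth 0%N l i)%N.
    by rewrite lt0n; apply: contraNneq l0 => <-; apply: mem_nth; exact: leq_ltn_trans ig gl.
  suff: false by [].
  by move: (nth _ _ _) e li ig sig => k; lia.
apply: contrapT => H.
have gN : (g.+1 <= N)%N by lia.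
have sg (i : 'I_g.+1) : (s (widen_ord gN i) < g)%N.
  rewrite ltnNge; apply/negP => gi; apply: H; exists (widen_ord gN i) => //.
  by rewrite /= -ltnS.
have inj : injective (fun i : 'I_g.+1 => Ordinal (sg i)).
  move=> i j /(congr1 val) /= /val_inj /perm_inj /(congr1 val) /= ij.
  exact/val_inj.
by have := leq_card _ inj; rewrite !card_ord ltnn.
Qed.

Lemma xi_part_curve l : is_partition l ->
  xi_part (curve_frame a) l = if size l == g
    then \det (\matrix_(i < g, j < g) (a j)`_(nth 0%N l i + g - i.+2)) else 0.
Proof.
move=> lp; set c := RHS.
have cE : exists N0, forall N, (N0 <= N)%N ->
    \det (\matrix_(i < N, j < N) xi (curve_frame a) ((nth 0%N l i)%:Z - i.+1%:Z) j) = c.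
  have detE N : \det (\matrix_(i < N, j < N)
      xi (curve_frame a) ((nth 0%N l i)%:Z - i.+1%:Z) j) =
      \det (\matrix_(i < N, j < N) ent l i j).
    by congr (\det _); apply/matrixP => i j; rewrite !mxE xi_ent.
  have [lg|gl] := leqP (size l) g; last first.
    exists (size l) => N lN; rewrite detE det_ent_long //.
    by rewrite /c; case: eqP gl => // ->; rewrite ltnn.
  exists g => N gN; rewrite detE (det_ent_stable _ lg gN) // /c.
  case: eqP => [slg|slg].
    congr (\det _); apply/matrixP => i j; rewrite !mxE /ent valK.
    have li : (0 < nth 0%N l i)%N.
      case/andP: lp => _ l0.
      by rewrite lt0n; apply: contraNneq l0 => <-; apply: mem_nth; rewrite slg.
    by rewrite ifT //; have := ltn_ord i; lia.
  (* With fewer than g parts the last of the g rows is zero: it would read the coefficients of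
     u^-1. *)
  have g1 : (g.-1 < g)%N by lia.
  rewrite (expand_det_row _ (Ordinal g1)) big1 // => j _; rewrite mxE /ent valK /=.
  by rewrite nth_default ?ifF ?mul0r //; lia.
rewrite /xi_part; case: xgetP => [x _ [N1 xE]|/(_ c)//].
case: cE => N2 cE; rewrite -(xE (maxn N1 N2)) ?leq_maxl // cE // leq_maxr //.
Qed.

Let M := (\max_j size (a j))%N.

Let aM j : (size (a j) <= M)%N.
Proof. exact: (leq_bigmax j). Qed.

(** [k i] is the exponent of u read by row i, that is λ_i + g - i - 2 with i counted from 0. For
    decreasing k it is at least g - 1 - i, so all g parts are positive. *)
Let lam (k : {ffun 'I_g -> 'I_M}) : seq nat :=
  mkseq (fun i => if insub i is Some i' then (k i' + i + 2 - g)%N else 0%N) g.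

Let decr_ge (k : {ffun 'I_g -> 'I_M}) (i : 'I_g) : decreasing k -> (g <= k i + i.+1)%N.
Proof.
move=> /decreasingP kd; have [d] := ubnP (g - i).
elim: d i => // d IH i; rewrite ltnS => id.
have [ig|] := ltnP i.+1 g; last by have := ltn_ord i; lia.
have := IH (Ordinal ig); rewrite /= => /(_ ltac:(lia)).
by have := kd i (Ordinal ig) (ltnSn _); lia.
Qed.

Let nth_lam (k : {ffun 'I_g -> 'I_M}) (i : 'I_g) : nth 0%N (lam k) i = (k i + i + 2 - g)%N.
Proof. by rewrite nth_mkseq // valK. Qed.

Let lam_partition (k : {ffun 'I_g -> 'I_M}) : decreasing k -> is_partition (lam k).
Proof.
move=> kd; apply/andP; split.
  apply/(sortedP 0%N) => m; rewrite size_mkseq => ig.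
  have ig' : (m < g)%N by lia.
  rewrite -[m]/(nat_of_ord (Ordinal ig')) -[_.+1]/(nat_of_ord (Ordinal ig)).
  rewrite !nth_lam /= /geq /=.
  by have := decreasingP _ kd (Ordinal ig') (Ordinal ig) (ltnSn _); lia.
apply/(nthP 0%N) => -[m]; rewrite size_mkseq => ig.
rewrite -[m]/(nat_of_ord (Ordinal ig)) nth_lam.
by have := decr_ge (Ordinal ig) kd => /=; lia.
Qed.

Let lam_inj : {in [pred k : {ffun 'I_g -> 'I_M} | decreasing k] &, injective lam}.
Proof.
move=> k k'; rewrite !inE => kd kd' e; apply/ffunP => i; apply/val_inj.
have := congr1 (fun l => nth 0%N l i) e; rewrite /= !nth_lam.
by have := decr_ge i kd; have := decr_ge i kd'; lia.
Qed.

(** Cauchy-Binet for the coefficients of the differentials times the shifted [sigmaz]: minors of the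
    first factor are the ξ_λ, those of the second the Schur-Weierstrass polynomials. *)
Lemma tau_curve : tau (curve_frame a) = series_of_xpoly (tau_det (@xvar R)).
Proof.
apply/funext => m; rewrite /tau /series_of_xpoly.
pose X : 'M[xpoly R]_(g, M) := \matrix_(j, k) ((a j)`_k)%:A.
pose Y : 'M[xpoly R]_(M, g) :=
  \matrix_(k, l) sigmaz (@xvar R) (k%:Z + (l%:Z + 2 - g%:Z)).
have -> : tau_det (@xvar R) = \det (X *m Y).
  congr (\det _); apply/matrixP => j l; rewrite !mxE.
  rewrite (big_ord_widen M (fun k => (a j)`_k *: sigmaz (@xvar R) (k%:Z + (l%:Z + 2 - g%:Z)))) //.
  rewrite big_mkcond; apply: eq_bigr => k _; rewrite !mxE -scalerAl mul1r.
  by case: ltnP => // jk; rewrite nth_default // scale0r.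
rewrite det_mulmx_decreasing raddf_sum /=.
(* A finite list of partitions that contains the support of the sum. *)
pose r := [seq lam k | k <- [seq k <- index_enum {ffun 'I_g -> 'I_M} | decreasing k]].
rewrite (fsbigE r); first last.
- move=> l /= lp lr; rewrite xi_part_curve //; case: eqP => [lg|_]; last by rewrite mul0r.
  have [->|dn0] := eqVneq (\det (\matrix_(i < g, j < g) (a j)`_(nth 0%N l i + g - i.+2))) 0.
    by rewrite mul0r.
  case/negP: lr.
  (* An exponent beyond all the degrees would produce a zero row. *)
  have kM (i : 'I_g) : (nth 0%N l i + g - i.+2 < M)%N.
    rewrite ltnNge; apply: contra dn0 => Mi.
    rewrite (expand_det_row _ i) big1 // => j _.
    by rewrite mxE nth_default ?mul0r // (leq_trans (aM j)).
  pose k := [ffun i => Ordinal (kM i)].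
  have l1 (i : 'I_g) : (0 < nth 0%N l i)%N.
    case/andP: lp => _ l0.
    by rewrite lt0n; apply: contraNneq l0 => <-; apply: mem_nth; rewrite lg.
  have kd : decreasing k.
    apply/decreasingP => i j ij; rewrite !ffunE /=.
    have lij : (nth 0%N l j <= nth 0%N l i)%N.
      case/andP: lp => ls _.
      have geq_tr : transitive geq by move=> ? ? ? /= h1 h2; exact: leq_trans h2 h1.
      have geq_refl : reflexive geq by move=> ?; exact: leqnn.
      by apply: (sorted_leq_nth geq_tr geq_refl 0%N ls); rewrite ?inE ?lg // ltnW.
    by have := ltn_ord j; have := l1 j; lia.
  apply/mapP; exists k; first by rewrite mem_filter kd mem_index_enum.
  apply: (@eq_from_nth _ 0%N); rewrite ?size_mkseq // lg => n ig.
  rewrite -[n]/(nat_of_ord (Ordinal ig)) nth_lam ffunE /=.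
  by have := l1 (Ordinal ig); rewrite /=; lia.
- by move=> l /= /mapP[k]; rewrite mem_filter => /andP[kd _] ->; exact: lam_partition.
- rewrite map_inj_in_uniq ?filter_uniq ?index_enum_uniq // => k k'.
  by rewrite !mem_filter => /andP[kd _] /andP[kd' _]; exact: lam_inj.
rewrite big_map big_filter_cond; apply: eq_big => [k|k /andP[kd _]].
  case: (boolP (decreasing k)) => //= kd; apply/asboolP; exact: lam_partition.
rewrite xi_part_curve; last exact: lam_partition.
rewrite size_mkseq eqxx.
have -> : schur_weierstrass (@xvar R) (lam k) = \det (rowsub k Y).
  rewrite /schur_weierstrass; have := size_mkseq (fun i => if insub i is Some i' then (k i' + i + 2 - g)%N else 0%N) g.
  rewrite -/(lam k) => slam.
  transitivity (\det (\matrix_(i < g, j < g)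
    sigmaz (@xvar R) ((nth 0%N (lam k) i)%:Z + j%:Z - i%:Z))).
    by case: _ / slam.
  congr (\det _); apply/matrixP => i j; rewrite !mxE nth_lam; congr sigmaz.
  by have := decr_ge i kd; lia.
have -> : colsub k X = map_mx (in_alg (xpoly R)) (\matrix_(j, i) (a j)`_(k i)).
  by apply/matrixP => i j; rewrite !mxE.
rewrite det_map_mx /= -scalerAl mul1r monalg.mcoeffZ -det_tr; congr (\det _ * _).
apply/matrixP => i j; rewrite !mxE nth_lam; congr (_ `_ _).
by have := decr_ge j kd; lia.
Qed.

End TauDeterminant.

(** * Values of tau on sums of points *)

Section TauEvaluation.

Variables (R : realType) (g : nat) (a : 'I_g -> {poly R[i]}).
Local Notation K := R[i].

Lemma sigma_morph (A B : comAlgType K) (phi : {rmorphism A -> B}) (x : nat -> A) n :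
  (forall c y, phi (c *: y) = c *: phi y) -> sigma (phi \o x) n = phi (sigma x n).
Proof.
move=> phiZ; rewrite /sigma rmorph_sum; apply: eq_bigr => k _.
rewrite phiZ; congr (_ *: _); rewrite -[RHS]coef_map /= rmorphXn /=.
congr (polyseq (_ ^+ k))`_n.
apply/polyP => i; rewrite [RHS]coef_map !coef_poly /=; case: ifP => _; last by rewrite rmorph0.
by case: (i : nat) => [|j] //; rewrite rmorph0.
Qed.

Lemma tau_det_morph (A B : comAlgType K) (phi : {rmorphism A -> B}) (x : nat -> A) :
  (forall c y, phi (c *: y) = c *: phi y) ->
  tau_det a (phi \o x) = phi (tau_det a x).
Proof.
move=> phiZ; rewrite /tau_det -det_map_mx; congr (\det _).
apply/matrixP => j l; rewrite !mxE rmorph_sum; apply: eq_bigr => k _.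
rewrite phiZ; congr (_ *: _); case: (_ + _ : int) => n; first exact: sigma_morph.
by rewrite /= rmorph0.
Qed.

(** Since the shifts are at most 1, only [sigma x n] with n <= N occur, and these involve only the
    first N variables. *)
Lemma eq_tau_det (A : comAlgType K) (x y : nat -> A) N :
  (forall j, (size (a j) <= N)%N) -> (forall i, (i < N)%N -> x i = y i) ->
  tau_det a x = tau_det a y.
Proof.
move=> aN xy; congr (\det _); apply/matrixP => j l; rewrite !mxE.
apply: eq_bigr => k _; congr (_ *: _); case En: (_ + _ : int) => [n|//] /=.
have nN : (n <= N)%N by have := ltn_ord l; have := ltn_ord k; have := aN j; lia.
rewrite /sigma; apply: eq_bigr => m _; congr (_ *: (polyseq (_ ^+ _))`_n).
apply/polyP => i; rewrite !coef_poly; case: ifP => // ilt.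
by case: (i : nat) ilt => // i' ilt; rewrite xy // (leq_trans _ nN).
Qed.

Definition tau_num (x : nat -> K) : K := @tau_det R g a K^o x.

Definition tau_col (x : nat -> K) (j : 'I_g) (l : int) : K :=
  \sum_(k < size (a j)) (a j)`_k * sgz x (k%:Z + l).

Lemma tau_numE x :
  tau_num x = \det (\matrix_(j < g, l < g) tau_col x j (l%:Z + 2 - g%:Z)).
Proof.
congr (\det _); apply/matrixP => j l; rewrite !mxE; apply: eq_bigr => k _.
by rewrite sgzE addrA.
Qed.

Lemma tau_num_polyfun n (F : nat -> ('I_n -> K) -> K) :
  (forall i, polyfun (F i)) -> polyfun (fun z => tau_num (fun i => F i z)).
Proof.
move=> PF; have /choice[p pE] : forall i, exists p : mpoly n K, forall v, F i v = meval v p.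
  exact: PF.
exists (tau_det a p) => v.
transitivity ((meval v : {rmorphism mpoly n K -> K^o}) (tau_det a p)); last by [].
rewrite -tau_det_morph; last by move=> c y; exact: mevalZ.
by congr (@tau_det R g a K^o _); apply/funext => i; rewrite pE.
Qed.

Lemma tau_col_addpt (x : nat -> K) p j l :
  tau_col (x \+ pt p) j l - p * tau_col (x \+ pt p) j (l - 1) = tau_col x j l.
Proof.
rewrite /tau_col mulr_sumr -sumrB; apply: eq_bigr => k _.
by rewrite -(sgz_addpt x p) mulrCA -mulrBr addrA.
Qed.

Lemma tau_col_addpts (s : seq K) : exists b : nat -> K, b 0%N = 1 /\
  forall x j l, \sum_(m < (size s).+1)
    b m * tau_col (fun i => x i + \sum_(p <- s) pt p i) j (l - m%:Z) = tau_col x j l.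
Proof.
have [b [b0 bE]] := sgz_addpts s; exists b; split=> // x j l.
under eq_bigr do rewrite /tau_col mulr_sumr.
rewrite exchange_big /=; apply: eq_bigr => k _.
by rewrite -bE mulr_sumr; apply: eq_bigr => m _; rewrite mulrCA addrA.
Qed.

(** Removing the g - 1 points is a combination of all g columns. It yields the column of x = 0 with
    shift 1, which is zero, while the coefficient b_0 = 1 makes the combination nontrivial. *)
Lemma tau_num_pts_eq0 (s : seq K) : (size s).+1 = g ->
  tau_num (fun i => \sum_(p <- s) pt p i) = 0.
Proof.
move=> sg; have [b [b0 bE]] := tau_col_addpts s.
rewrite tau_numE; set C := \matrix_(_, _) _.
apply/eqP/contraT => Cn0.
have Cu : C \in unitmx by rewrite unitmxE unitfE.
(* Reversed, because column l has shift 1 - (g - 1 - l). *)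
pose w : 'cV[K]_g := \col_l b (g.-1 - l)%N.
have Cw : C *m w = 0.
  apply/colP => j; rewrite !mxE.
  transitivity (tau_col (fun=> 0) j 1).
    rewrite -bE sg [RHS](reindex_inj rev_ord_inj) /=; apply: eq_bigr => l _.
    rewrite !mxE mulrC; congr (b _ * tau_col _ j _).
    - by have := ltn_ord l; lia.
    - by apply/funext => n; rewrite add0r.
    - by have := ltn_ord l; lia.
  rewrite /tau_col big1 // => k _; rewrite sgz0.
  by rewrite (_ : _ == 0 = false) ?mulr0 //; apply/eqP; lia.
have w0 : w = 0 by rewrite -[w](mulKmx Cu) Cw mulmx0.
have g1 : (g.-1 < g)%N by rewrite -sg.
have := congr1 (fun u : 'cV[K]_g => u (Ordinal g1) 0) w0.
by rewrite /w !mxE /= subnn b0 => /eqP; rewrite oner_eq0.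
Qed.

(* The g - 1 other points can be removed by a column operation, which turns the
   matrix of tau into (p_i a_j(p_i)). *)
Lemma tau_num_pts_neq0 (p : 'I_g -> K) : (forall i, p i != 0) ->
  \det (\matrix_(j, i) (a j).[p i]) != 0 ->
  tau_num (fun n => \sum_i pt (p i) n) != 0.
Proof.
move=> pn0 an0.
pose s i := [seq p k | k <- enum 'I_g & k != i].
have ss i : (size (s i)).+1 = g.
  have := count_predC (pred1 i) (enum 'I_g).
  rewrite count_uniq_mem ?enum_uniq // mem_enum size_enum_ord add1n => <-.
  by rewrite size_map size_filter.
have /choice[b bE] : forall i, exists b : nat -> K, b 0%N = 1 /\
  forall x j l, \sum_(m < (size (s i)).+1)
    b m * tau_col (fun n => x n + \sum_(p <- s i) pt p n) j (l - m%:Z) = tau_col x j l.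
  by move=> i; exact: tau_col_addpts.
pose X n := \sum_i pt (p i) n.
have XE i n : X n = pt (p i) n + \sum_(q <- s i) pt q n.
  rewrite /X (bigD1 i) //= /s big_map big_filter; congr (_ + _).
  by rewrite big_enum_cond.
have colE i j : \sum_(m < g) b i m * tau_col X j (1 - m%:Z) = p i * (a j).[p i].
  have [_ /(_ (pt (p i)) j 1)] := bE i.
  rewrite ss (_ : (fun n => _) = X); last by apply/funext => n; rewrite (XE i).
  move=> ->; rewrite horner_coef mulr_sumr; apply: eq_bigr => k _.
  by rewrite -[_ + 1]/(k + 1)%N%:Z sgz_pt addn1 exprS mulrCA.
rewrite tau_numE; set C := \matrix_(_, _) _.
pose Q : 'M[K]_g := \matrix_(l, i) b i (g.-1 - l)%N.
have CQ : C *m Q = (\matrix_(j, i) (a j).[p i]) *m diag_mx (\row_i p i).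
  apply/matrixP => j i; rewrite mul_mx_diag !mxE mulrC -colE.
  rewrite [RHS](reindex_inj rev_ord_inj) /=; apply: eq_bigr => l _.
  rewrite !mxE mulrC; congr (b i _ * tau_col _ j _).
  - by have := ltn_ord l; lia.
  - by have := ltn_ord l; lia.
apply: contra_neq an0 => C0.
have := congr1 determinant CQ; rewrite !det_mulmx C0 mul0r det_diag => /esym/eqP.
rewrite mulf_eq0 => /orP[/eqP//|/prodf_eq0[i _]].
by rewrite mxE (negPf (pn0 i)).
Qed.

(** Subtracting [pt s] multiplies the exponential by 1 - s t, so every entry becomes affine in s. *)
Lemma tau_num_subpt (x : nat -> K) : exists P : {poly K}, (size P <= g.+1)%N /\
  forall s, P.[s] = tau_num (fun n => x n - pt s n).
Proof.
exists (\det (\matrix_(j < g, l < g) ((tau_col x j (l%:Z + 2 - g%:Z))%:P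
           - (tau_col x j (l%:Z + 2 - g%:Z - 1))%:P * 'X))); split=> [|s].
  rewrite /determinant; apply: (leq_trans (size_sum _ _ _)); apply/bigmax_leqP => s _.
  rewrite -signr_odd; apply: (@leq_trans (size (\prod_(i < g)
    (\matrix_(j < g, l < g) ((tau_col x j (l%:Z + 2 - g%:Z))%:P
           - (tau_col x j (l%:Z + 2 - g%:Z - 1))%:P * 'X)) i (s i)))).
    by case: (odd _); rewrite ?expr1 ?expr0 ?mul1r // mulN1r size_polyN.
  apply: leq_trans (size_prod_leq _ _) _.
  rewrite leq_subLR card_ord; apply: (@leq_trans (\sum_(i < g) 2).+1); last first.
    by rewrite sum_nat_const card_ord; lia.
  rewrite ltnS; apply: leq_sum => i _; rewrite mxE.
  apply: leq_trans (size_polyD _ _) _.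
  rewrite geq_max (leq_trans (size_polyC_leq1 _)) // size_polyN.
  by apply: leq_trans (size_polyMleq _ _) _; rewrite size_polyX addn2 ltnS size_polyC_leq1.
rewrite -horner_evalE -det_map_mx tau_numE; congr (\det _).
apply/matrixP => j l; rewrite !mxE /= /horner_eval hornerD hornerN hornerM !hornerC hornerX.
rewrite -(tau_col_addpt (fun n => x n - pt s n) s) mulrC.
have -> : (fun n => x n - pt s n) \+ pt s = x by apply/funext => n /=; rewrite subrK.
by [].
Qed.

End TauEvaluation.

(** * Invariance of tau under the kernel of A *)

Section Nilpotent.

Variable K : fieldType.

(** By the geometric series det(1 + X N) is a unit of K[X], hence a constant; it is compared at X =
    0 and X = 1. *)
Lemma det_add1_nilpotent g n (N : 'M[K]_g) : N ^+ n = 0 -> \det (1%:M + N) = 1.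
Proof.
move=> Nn0; pose Z : 'M[{poly K}]_g := - 'X *: map_mx polyC N.
have Zn0 : Z ^+ n = 0.
  have ZE k : Z ^+ k = (- 'X) ^+ k *: map_mx polyC (N ^+ k).
    elim: k => [|k IH]; first by rewrite !expr0 scale1r -[RHS]/(map_mx _ 1%:M) map_mx1.
    by rewrite !exprS IH -[Z * _]/(Z *m _) -scalemxAl -scalemxAr scalerA -map_mxM.
  by rewrite ZE Nn0 map_mx0 scaler0.
pose p := \det (1%:M - Z).
have pu : p * \det (\sum_(i < n) Z ^+ i) = 1.
  rewrite -det_mulmx (_ : _ *m _ = 1%:M) ?det1 //.
  transitivity ((1 - Z) * \sum_(i < n) Z ^+ i) => //.
  by rewrite -opprB mulNr -subrX1 Zn0 sub0r opprK.
have ps : (size p <= 1)%N.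
  have p1 : p %| 1 by apply/dvdpP; exists (\det (\sum_(i < n) Z ^+ i)); rewrite mulrC pu.
  by move: p1; rewrite dvdp1 => /eqP ->.
have pE c : p.[c] = \det (1%:M + c *: N).
  rewrite -horner_evalE -det_map_mx; congr (\det _); apply/matrixP => i j.
  rewrite !mxE /= /horner_eval hornerD hornerN hornerM hornerN hornerX hornerC mulNr opprK.
  by rewrite hornerMn hornerC.
have [c pc] : {c | p = c%:P} by exists p`_0; rewrite [LHS]size1_polyC.
have := pE 1; have := pE 0.
by rewrite scale0r addr0 det1 scale1r pc !hornerC => -> <-.
Qed.

(** Take A of maximal rank with rows in P; a vector of P outside its row space would increase the
    rank. *)
Lemma subspace_mx n (P : 'rV[K]_n -> Prop) :
  P 0 -> (forall c v w, P v -> P w -> P (c *: v + w)) ->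
  exists A : 'M[K]_n, forall v, P v <-> (v <= A)%MS.
Proof.
move=> P0 Plin.
have Pmul m (A : 'M[K]_(m, n)) (u : 'rV_m) : (forall i, P (row i A)) -> P (u *m A).
  move=> PA; rewrite mulmx_sum_row; elim/big_ind: _ => // [v w|i _].
    by rewrite -[v in v + w]scale1r; exact: Plin.
  by rewrite -[_ *: _]addr0; exact: Plin.
pose Q r := `[< exists A : 'M[K]_n, \rank A = r /\ forall i, P (row i A) >].
have Q0 : exists r, Q r.
  exists 0%N; apply/asboolP; exists 0; split; first exact: mxrank0.
  by move=> i; rewrite row0.
have Qn r : Q r -> (r <= n)%N by move=> /asboolP[A [<- _]]; exact: rank_leq_col.
case: (ex_maxnP Q0 Qn) => r /asboolP[A [rA PA]] rmax.
exists A => v; split=> [Pv|/submxP[u ->]]; last exact: Pmul.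
apply: contrapT => /negP vA.
have : Q (\rank (A + v)%MS).
  apply/asboolP; exists (A + v)%MS; split=> // i.
  have /sub_addsmxP[[u1 u2] /= ->] : (row i (A + v)%MS <= A + v)%MS by exact: row_sub.
  rewrite -[u1 *m A]scale1r; apply: Plin; first exact: Pmul.
  by apply: Pmul => k; rewrite row_id.
move=> /rmax; rewrite -rA leqNgt => /negP; apply.
by apply: rank_ltmx; rewrite ltmxE addsmxSl addsmx_sub submx_refl.
Qed.

End Nilpotent.

(** * Duality between the local ring and the differentials, and translation invariance *)

Section Duality.

Variables (R : realType) (g : nat) (a : 'I_g -> {poly R[i]}).
Local Notation K := R[i].

(* With t = 1/u, this is the residue of - f(t) p(u) du at u = oo. *)
Definition pairing (f p : {poly K}) : K := \sum_(k < size p) p`_k * f`_k.+1.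

Lemma pairing_wide n (f p : {poly K}) : (size p <= n)%N ->
  pairing f p = \sum_(k < n) p`_k * f`_k.+1.
Proof.
move=> pn; rewrite /pairing (big_ord_widen n (fun k => p`_k * f`_k.+1)) //.
rewrite big_mkcond; apply: eq_bigr => k _; case: ltnP => // pk.
by rewrite nth_default ?mul0r.
Qed.

Lemma pairing_sumr (f : {poly K}) (c : 'I_g -> K) :
  pairing f (\sum_j c j *: a j) = \sum_j c j * pairing f (a j).
Proof.
pose n := maxn (size (\sum_j c j *: a j)) (\max_j size (a j)).
have an j : (size (a j) <= n)%N by rewrite leq_max (leq_bigmax j) orbT.
rewrite (@pairing_wide n) ?leq_maxl //.
under [RHS]eq_bigr do rewrite (@pairing_wide n) // mulr_sumr.
rewrite exchange_big /=; apply: eq_bigr => k _.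
by rewrite coef_sum mulr_suml; apply: eq_bigr => j _; rewrite coefZ mulrA.
Qed.

(* V stands for the polynomials in t lying in the local ring of the singular
   point, and a for the basis of the regular differentials. *)
Variables (V : {poly K} -> Prop) (N0 : nat).
Hypothesis V_cst : forall c, V c%:P.
Hypothesis V_sub : forall f h, V f -> V h -> V (f - h).
Hypothesis V_mul : forall f h, V f -> V h -> V (f * h).
Hypothesis V_conductor : forall f, V ('X^N0 * f).
Hypothesis a_perp : forall f j, V f -> pairing f (a j) = 0.
Hypothesis a_span : forall p, (forall f, V f -> pairing f p = 0) ->
  exists c : 'I_g -> K, p = \sum_j c j *: a j.
Hypothesis a_free : forall c : 'I_g -> K, \sum_j c j *: a j = 0 -> forall j, c j = 0.

Let V_add f h : V f -> V h -> V (f + h).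
Proof.
move=> Vf Vh; rewrite -[h]opprK; apply: V_sub => //.
by rewrite -[- h]add0r; apply: V_sub => //; rewrite -polyC0.
Qed.

Let V_scale c f : V f -> V (c *: f).
Proof. by move=> Vf; rewrite -mul_polyC; exact: V_mul. Qed.

(** After truncation, V is the common kernel of finitely many linear forms. Each is the pairing with
    some p orthogonal to V, hence with a combination of the [a j]. *)
Lemma double_orthogonal (y : {poly K}) : (forall j, pairing y (a j) = 0) -> V y.
Proof.
move=> ya; pose N := N0.+1.
have Vtrunc f : V f <-> V (rVpoly (poly_rV f : 'rV_N)).
  have fE : f - rVpoly (poly_rV f : 'rV_N) = 'X^N0 * ('X * drop_poly N f).
    apply/polyP => k; rewrite mulrA -exprSr coefB coef_rVpoly coefXnM.
    case: insubP => [i ki ik|]; first by rewrite mxE ik subrr ki.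
    by rewrite -leqNgt coef_drop_poly subr0 leqNgt => /negPf kN; rewrite kN subnK // leqNgt kN.
  split=> Vf.
    by rewrite -(subKr f (rVpoly _)) fE; exact: V_sub.
  by rewrite -(subrK (rVpoly (poly_rV f : 'rV_N)) f) fE; exact: V_add.
have [||A AE] := @subspace_mx K N (fun v => V (rVpoly v)).
- by rewrite linear0 -polyC0.
- by move=> c v w Vv Vw; rewrite linearP; apply: V_add => //; exact: V_scale.
apply/Vtrunc/AE; rewrite submxE; apply/eqP/rowP => k; rewrite mxE [RHS]mxE.
(* One of the linear forms that cut out the truncation of V. *)
pose lam i : K := if insub i is Some i' then cokermx A i' k else 0.
have lamE f : V f -> \sum_(i < N) f`_i * lam i = 0.
  move=> /Vtrunc/AE; rewrite submxE => /eqP/rowP/(_ k); rewrite mxE [RHS]mxE => fA.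
  by rewrite -[RHS]fA; apply: eq_bigr => i _; rewrite mxE /lam valK.
(* The pairing ignores the constant coefficient; constants belong to V, so the form ignores it
   too. *)
have lam0 : lam 0%N = 0.
  have := lamE _ (V_cst 1); rewrite big_ord_recl coef1 mul1r big1 ?addr0 // => i _.
  by rewrite coef1 mul0r.
pose p := \poly_(i < N0) lam i.+1.
have pairE f : pairing f p = \sum_(i < N) f`_i * lam i.
  rewrite (@pairing_wide N0) ?size_poly // [RHS]big_ord_recl lam0 mulr0 add0r.
  by apply: eq_bigr => i _; rewrite coef_poly ltn_ord mulrC.
have [f Vf|c pE] := @a_span p; first by rewrite pairE lamE.
transitivity (pairing y p).
  by rewrite pairE; apply: eq_bigr => i _; rewrite mxE /lam valK.
by rewrite pE pairing_sumr big1 // => j _; rewrite ya mulr0.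
Qed.

(* Regrouping of a double sum over k and i by d = k - i, when F(d) = 0 for
   d < -1. *)
Lemma sum_by_difference n (p : {poly K}) (s : nat -> K) (F : int -> K) :
  (forall m : nat, F (- m.+2%:Z) = 0) ->
  \sum_(k < n) p`_k * (\sum_(i < n.+1) s i * F (k%:Z - i%:Z)) =
  \sum_(d < n) (\sum_(k < n | (d <= k)%N) p`_k * s (k - d)%N) * F d
    + (\sum_(k < n) p`_k * s k.+1) * F (- 1).
Proof.
move=> F0.
have inner (k : 'I_n) : \sum_(i < n.+1) s i * F (k%:Z - i%:Z) =
    \sum_(d < n | (d <= k)%N) s (k - d)%N * F d + s k.+1 * F (- 1).
  have kn := ltn_ord k.
  rewrite -(big_mkord xpredT (fun i => s i * F (k%:Z - i%:Z))).
  rewrite (@big_cat_nat _ _ _ k.+1) //=; last by lia.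
  congr (_ + _).
    rewrite big_mkord -[RHS](big_ord_widen n (fun d => s (k - d)%N * F d) kn).
    rewrite (reindex_inj rev_ord_inj) /=; apply: eq_bigr => i _.
    by have ik := ltn_ord i; congr (s _ * F _); lia.
  rewrite big_ltn; last by lia.
  rewrite big_nat big1 ?addr0 => [|i /andP[ik _]].
    by congr (_ * F _); lia.
  have -> : k%:Z - i%:Z = - (i - k - 2).+2%:Z by lia.
  by rewrite F0 mulr0.
under eq_bigr do rewrite inner mulrDr.
rewrite big_split /=; congr (_ + _); last first.
  by rewrite mulr_suml; apply: eq_bigr => k _; rewrite mulrA.
under eq_bigr do rewrite mulr_sumr big_mkcond.
rewrite exchange_big /=; apply: eq_bigr => d _.
rewrite mulr_suml [RHS]big_mkcond; apply: eq_bigr => k _.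
by case: ifP => // _; rewrite mulrA.
Qed.

Let n := (\max_j size (a j))%N.

Let an j : (size (a j) <= n)%N.
Proof. exact: (leq_bigmax j). Qed.

Let coefs : 'M[K]_(g, n) := \matrix_(j, k) (a j)`_k.

Let coefs_free : row_free coefs.
Proof.
apply/inj_row_free => v va0; apply/rowP => j; rewrite mxE.
apply: (a_free (c := fun j => v 0 j)); apply/polyP => k; rewrite coef_sum coef0.
have [kn|nk] := ltnP k n; last first.
  by rewrite big1 // => i _; rewrite coefZ nth_default ?mulr0 // (leq_trans _ nk).
transitivity ((v *m coefs) 0 (Ordinal kn)); last by rewrite va0 mxE.
by rewrite mxE; apply: eq_bigr => i _; rewrite coefZ mxE.
Qed.

Section Translation.

Variable y : nat -> K.
Hypothesis ya : forall j, \sum_(k < size (a j)) (a j)`_k * y k = 0.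

Let e := texp n.+1 (xpol y n.+1).

Let eE i : (i <= n.+1)%N -> e`_i = sg y i.
Proof.
move=> ilt; apply: coef_texp => //; first exact: xpol0.
by move=> k ki; rewrite xpolS //; lia.
Qed.

Let V_e : V e.
Proof.
have Vy : V (xpol y n.+1).
  apply: double_orthogonal => j; rewrite -[RHS](ya j); apply: eq_bigr => k _.
  by rewrite xpolS //; have := ltn_ord k; have := an j; lia.
rewrite /e /texp; elim/big_ind: _ => [|f h|k _].
- by rewrite -polyC0.
- exact: V_add.
- apply: V_scale; elim: (k : nat) => [|m IH]; first by rewrite expr0 -polyC1.
  by rewrite exprS; exact: V_mul.
Qed.

Let sgy_perp j : \sum_(k < n) (a j)`_k * sg y k.+1 = 0.
Proof.
rewrite -[RHS](a_perp j V_e) (pairing_wide _ (an j)); apply: eq_bigr => k _.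
by rewrite eE // ltnS ltnW.
Qed.

(* The regular part of exp(y) a_j du. *)
Let b j : {poly K} := \poly_(d < n) \sum_(k < n | (d <= k)%N) (a j)`_k * sg y (k - d)%N.

(** Pairing f with [b j] amounts to pairing exp(y) f with [a j], up to a multiple of f(0) that
    [sgy_perp] kills. *)
Let b_span j : exists c : 'I_g -> K, b j = \sum_i c i *: a i.
Proof.
apply: a_span => f Vf.
rewrite -[RHS](a_perp j (V_mul V_e Vf)) (pairing_wide _ (an j)).
rewrite (@pairing_wide n) ?size_poly //.
(* [F m] is the coefficient of t^(m+1) in f; [Negz 0] is -1. *)
pose F (m : int) := if m is Posz m' then f`_m'.+1 else if m is Negz 0 then f`_0 else 0.
transitivity (\sum_(k < n) (a j)`_k * (\sum_(i < n.+1) sg y i * F (k%:Z - i%:Z))).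
  rewrite sum_by_difference // sgy_perp mul0r addr0.
  by apply: eq_bigr => d _; rewrite coef_poly ltn_ord.
apply: eq_bigr => k _; congr (_ * _); rewrite coefM.
have kn := ltn_ord k.
rewrite (big_ord_widen n.+1 (fun i => e`_i * f`_(k.+1 - i))); last by lia.
rewrite [RHS]big_mkcond; apply: eq_bigr => i _; have ilt := ltn_ord i.
case: ltnP => ik.
  rewrite eE; last by lia.
  congr (_ * _); have [ik'|ki] := leqP i k.
    have -> : k%:Z - i%:Z = (k - i)%N by lia.
    by rewrite /= subSn.
  have -> : k%:Z - i%:Z = Negz 0 by lia.
  by have -> : (k.+1 - i = 0)%N by lia.
have -> : k%:Z - i%:Z = Negz (i - k - 2).+1 by lia.
by rewrite mulr0.
Qed.

(** Translation by y multiplies the matrix of tau by M, the action of exp(y) on the span of the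
    [a j]. M is unipotent because [coefs] intertwines M - 1 with the strictly triangular S. *)
Lemma tau_num_translate (x : nat -> K) : tau_num a (x \+ y) = tau_num a x.
Proof.
have /choice[c cE] := b_span.
pose M : 'M[K]_g := \matrix_(j, i) c j i.
pose S : 'M[K]_n := \matrix_(k, d) if (d < k)%N then sg y (k - d)%N else 0.
have MS : M *m coefs = coefs *m (1%:M + S).
  apply/matrixP => j d; rewrite !mxE.
  transitivity ((b j)`_d).
    by rewrite cE coef_sum; apply: eq_bigr => i _; rewrite coefZ !mxE.
  rewrite coef_poly ltn_ord big_mkcond; apply: eq_bigr => k _; rewrite !mxE.
  rewrite leq_eqVlt [d == k :> nat]eq_sym -val_eqE.
  case: (ltngtP k d) => [||kd] /=; rewrite ?addr0 ?add0r ?mulr0 //.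
  by rewrite kd subnn sg0.
have S_nil k (i d : 'I_n) : (i < d + k)%N -> (S ^+ k) i d = 0.
  elim: k i d => [|k IH] i d.
    by rewrite addn0 expr0 !mxE -val_eqE; case: ltngtP.
  move=> idk; rewrite exprS -[S * _]/(S *m _) mxE big1 // => l _; rewrite mxE.
  by case: ltnP => li; rewrite ?mul0r // IH ?mulr0 //; lia.
have Snn : S ^+ n = 0.
  by apply/matrixP => i d; rewrite S_nil ?mxE //; have := ltn_ord i; lia.
have NE : (M - 1%:M) *m coefs = coefs *m S.
  by rewrite mulmxBl MS mulmxDr mulmx1 mul1mx addrAC subrr add0r.
have Nn0 : (M - 1%:M) ^+ n = 0.
  have NkE k : (M - 1%:M) ^+ k *m coefs = coefs *m S ^+ k.
    elim: k => [|k IH]; first by rewrite !expr0 mulmx1 mul1mx.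
    rewrite exprS exprSr -[_ * _ ^+ k]/(_ *m _) -mulmxA IH mulmxA NE -mulmxA.
    by rewrite -[S ^+ k * S]/(_ *m _) -[S *m _]/(S * _) -exprS exprSr.
  by apply: (row_free_inj coefs_free); rewrite NkE Snn mulmx0 mul0mx.
rewrite !tau_numE -[RHS]mul1r -(det_add1_nilpotent Nn0) addrC subrK -det_mulmx.
congr (\det _); apply/matrixP => j l; rewrite !mxE.
set L := l%:Z + 2 - g%:Z.
(* With shifts at most 1, differences below -1 contribute nothing, and the difference -1 carries the
   factor killed by [sgy_perp]. *)
have L1 : L <= 1 by rewrite /L; have := ltn_ord l; lia.
have tau_colE z i : tau_col a z i L = \sum_(k < n) (a i)`_k * sgz z (k%:Z + L).
  rewrite /tau_col (big_ord_widen n (fun k => (a i)`_k * sgz z (k%:Z + L))) //.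
  rewrite big_mkcond; apply: eq_bigr => k _.
  by case: ltnP => // ik; rewrite nth_default ?mul0r.
have sgz_neg z (m : int) : m < 0 -> sgz z m = 0 by case: m.
transitivity (\sum_(k < n) (a j)`_k * (\sum_(i < n.+1) sg y i * sgz x (k%:Z - i%:Z + L))).
  rewrite tau_colE; apply: eq_bigr => k _; congr (_ * _).
  case E: (k%:Z + L) => [m|m].
    have mn : (m.+1 <= n.+1)%N by have := ltn_ord k; lia.
    have -> : x \+ y = y \+ x by apply/funext => i; exact: addrC.
    rewrite [LHS]sgD (big_ord_widen _ (fun i => sg y i * sg x (m - i)%N) mn).
    rewrite big_mkcond; apply: eq_bigr => i _; case: ltnP => im.
      by have -> : k%:Z - i%:Z + L = (m - i)%N by lia.
    by rewrite sgz_neg ?mulr0 //; lia.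
  rewrite [LHS]/= big1 // => i _.
  by rewrite sgz_neg ?mulr0 //; lia.
rewrite (@sum_by_difference _ _ _ (fun m => sgz x (m + L))) => [|m]; last first.
  by rewrite sgz_neg //; lia.
rewrite sgy_perp mul0r addr0.
transitivity (\sum_(d < n) (b j)`_d * sgz x (d%:Z + L)).
  by apply: eq_bigr => d _; rewrite coef_poly ltn_ord.
under [RHS]eq_bigr do rewrite !mxE tau_colE mulr_sumr.
rewrite exchange_big; apply: eq_bigr => d _ /=.
by rewrite cE coef_sum mulr_suml; apply: eq_bigr => i _; rewrite coefZ mulrA.
Qed.

End Translation.

(* A right inverse of the period matrix gives the factorization. *)
Lemma tau_num_factor : exists T : mpoly g K, forall x : nat -> K,
  tau_num a x = meval (fun j => \sum_(k < size (a j)) (a j)`_k * x k) T.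
Proof.
pose B := pinvmx coefs.
pose F i (z : 'I_g -> K) : K := if insub i is Some i' then \sum_j B i' j * z j else 0.
have PF (i : nat) : polyfun (F i).
  rewrite /F; case: (insub i) => [i'|]; last exact: polyfun_cst.
  apply: polyfun_sum => j _; apply: polyfunM; [exact: polyfun_cst|exact: polyfun_var].
have [T TE] := tau_num_polyfun a PF.
exists T => x; pose z (j : 'I_g) : K := \sum_(k < size (a j)) (a j)`_k * x k.
rewrite -[RHS]/(meval z T) -TE.
(* The difference between x and the chosen preimage of z, a kernel vector; tau does not see the
   coordinates from n on. *)
pose y i := if (i < n)%N then x i - F i z else 0.
have zE j : z j = \sum_(k < n) (a j)`_k * x k.
  rewrite /z (big_ord_widen n (fun k => (a j)`_k * x k)) // big_mkcond.
  by apply: eq_bigr => k _; case: ltnP => // jk; rewrite nth_default ?mul0r.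
rewrite -[RHS](@tau_num_translate y) => [|j].
  rewrite /tau_num; apply: (@eq_tau_det R g a K^o x (F^~ z \+ y) n) => // i ilt.
  by rewrite /= /y ilt addrC subrK.
transitivity (\sum_(k < n) (a j)`_k * y k).
  rewrite (big_ord_widen n (fun k => (a j)`_k * y k)) // big_mkcond.
  by apply: eq_bigr => k _; case: ltnP => // jk; rewrite nth_default ?mul0r.
under eq_bigr => k _ do rewrite /y ltn_ord mulrBr.
rewrite sumrB -zE; apply/eqP; rewrite subr_eq0; apply/eqP.
pose zc : 'cV[K]_g := \col_i z i.
transitivity ((coefs *m (B *m zc)) j 0).
  by rewrite mulmxA mulmxVp // mul1mx mxE.
rewrite mxE; apply: eq_bigr => k _; rewrite [coefs _ _]mxE /F valK; congr (_ * _).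
by rewrite mxE; apply: eq_bigr => i _; rewrite [zc _ _]mxE.
Qed.

End Duality.

(** * Residues and regular differentials *)

Section RationalFunctions.

Variable R : realType.
Local Notation K := R[i].
Local Notation ratfun := (ratfun R).
Local Notation cst := (@Defs.cst R).
Local Notation of_poly := (@of_poly R).
Implicit Types (p q s f : {poly K}) (F h : ratfun) (c : K).

Lemma of_polyD p q : of_poly (p + q) = of_poly p + of_poly q.
Proof. exact: rmorphD. Qed.

Lemma of_polyB p q : of_poly (p - q) = of_poly p - of_poly q.
Proof. exact: rmorphB. Qed.

Lemma of_polyM p q : of_poly (p * q) = of_poly p * of_poly q.
Proof. exact: rmorphM. Qed.

Lemma of_poly0 : of_poly (0 : {poly K}) = 0.
Proof. exact: rmorph0. Qed.

Lemma of_poly1 : of_poly (1 : {poly K}) = 1.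
Proof. exact: rmorph1. Qed.

Lemma of_polyXn p n : of_poly (p ^+ n) = of_poly p ^+ n.
Proof. exact: rmorphXn. Qed.

Lemma of_poly_inj : injective of_poly.
Proof. by move=> p q /eqP; rewrite tofrac_eq => /eqP. Qed.

Lemma of_poly_eq0 p : (of_poly p == 0) = (p == 0).
Proof. exact: tofrac_eq0. Qed.

Lemma of_poly_neq0 p : p != 0 -> of_poly p != 0.
Proof. by rewrite of_poly_eq0. Qed.

Lemma of_polyZ c p : of_poly (c *: p) = cst c * of_poly p.
Proof. by rewrite -mul_polyC of_polyM. Qed.

Lemma cstB c c' : cst (c - c') = cst c - cst c' :> ratfun.
Proof. by rewrite /cst polyCB of_polyB. Qed.

Lemma cstD c c' : cst (c + c') = cst c + cst c' :> ratfun.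
Proof. by rewrite /cst polyCD of_polyD. Qed.

Lemma cstM c c' : cst (c * c') = cst c * cst c' :> ratfun.
Proof. by rewrite /cst polyCM of_polyM. Qed.

Lemma cst0 : cst 0 = 0 :> ratfun.
Proof. exact: of_poly0. Qed.

Lemma u_neq0 : u_ R != 0.
Proof. by rewrite of_poly_eq0 polyX_eq0. Qed.

Definition rsubst f (w : ratfun) : ratfun := (map_poly cst f).[w].

Lemma rsubstE f w : rsubst f w = (map_poly ((@tofrac _ \o polyC) : {rmorphism K -> ratfun}) f).[w].
Proof. by []. Qed.

Lemma rsubstD f f' w : rsubst (f + f') w = rsubst f w + rsubst f' w.
Proof. by rewrite !rsubstE rmorphD hornerD. Qed.

Lemma rsubstB f f' w : rsubst (f - f') w = rsubst f w - rsubst f' w.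
Proof. by rewrite !rsubstE rmorphB hornerD hornerN. Qed.

Lemma rsubstM f f' w : rsubst (f * f') w = rsubst f w * rsubst f' w.
Proof. by rewrite !rsubstE rmorphM hornerM. Qed.

Lemma rsubstC c w : rsubst c%:P w = cst c.
Proof. by rewrite rsubstE map_polyC hornerC. Qed.

Lemma rsubstX w : rsubst 'X w = w.
Proof. by rewrite rsubstE map_polyX hornerX. Qed.

Lemma rsubstXn n w : rsubst 'X^n w = w ^+ n.
Proof. by rewrite rsubstE map_polyXn hornerXn. Qed.

Lemma rsubst_split f w : rsubst f w = cst f`_0 + w * rsubst (drop_poly 1 f) w.
Proof.
have {1}-> : f = (f`_0)%:P + 'X * drop_poly 1 f.
  apply/polyP => k; rewrite coefD coefC coefXM coef_drop_poly.
  by case: k => [|k] /=; rewrite ?addr0 // add0r addn1.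
by rewrite rsubstD rsubstM rsubstC rsubstX.
Qed.

Lemma regular_cst Q c : regular_at Q (cst c : ratfun).
Proof.
case: Q => [x|] /=.
  by exists c%:P, 1; rewrite hornerC oner_eq0 of_poly1 divr1.
exists c%:P, 1; split; [exact: oner_neq0| |by rewrite of_poly1 divr1].
by apply: leq_trans (size_polyC_leq1 c) _; rewrite size_poly1.
Qed.

Lemma regularD Q h h' : regular_at Q h -> regular_at Q h' -> regular_at Q (h + h').
Proof.
have fracD p q p' q' : q != 0 -> q' != 0 ->
    of_poly p / of_poly q + of_poly p' / of_poly q'
    = of_poly (p * q' + p' * q) / of_poly (q * q').
  by move=> q0 q0'; rewrite addf_div ?of_poly_eq0 // of_polyD !of_polyM.
have nz (x : K) q : q.[x] != 0 -> q != 0 by apply: contra_neq => ->; rewrite horner0.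
case: Q => [x|] /= [p [q H]] [p' [q' H']].
  case: H H' => [q0 ->] [q0' ->]; exists (p * q' + p' * q), (q * q').
  by rewrite hornerM mulf_neq0 // fracD //; apply: nz; eassumption.
case: H H' => [q0 pq ->] [q0' pq' ->]; exists (p * q' + p' * q), (q * q').
split; [by rewrite mulf_neq0| |by rewrite fracD].
rewrite [X in (_ <= X)%N]size_mul //.
apply: (leq_trans (size_polyD _ _)); rewrite geq_max.
apply/andP; split; apply: leq_trans (size_polyMleq _ _) _; rewrite -!subn1 leq_sub2r //.
  by rewrite leq_add2r.
by rewrite addnC leq_add2l.
Qed.

Lemma regularM Q h h' : regular_at Q h -> regular_at Q h' -> regular_at Q (h * h').
Proof.
case: Q => [x|] /= [p [q H]] [p' [q' H']].
  case: H H' => [q0 ->] [q0' ->]; exists (p * p'), (q * q').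
  by rewrite hornerM mulf_neq0 // mulf_div !of_polyM.
case: H H' => [q0 pq ->] [q0' pq' ->]; exists (p * p'), (q * q').
split; [by rewrite mulf_neq0| |by rewrite mulf_div !of_polyM].
rewrite [X in (_ <= X)%N]size_mul //; apply: leq_trans (size_polyMleq _ _) _.
by rewrite -!subn1 leq_sub2r // leq_add.
Qed.

Lemma regularB Q h h' : regular_at Q h -> regular_at Q h' -> regular_at Q (h - h').
Proof.
move=> rh rh'; apply: regularD => //.
have -> : - h' = cst (- 1) * h' by rewrite -[- 1]sub0r cstB cst0 sub0r mulN1r.
by apply: regularM => //; exact: regular_cst.
Qed.

Lemma regular_uV : regular_at None (u_ R)^-1.
Proof.
by exists 1, 'X; split; rewrite ?polyX_eq0 ?size_poly1 ?size_polyX // of_poly1 div1r.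
Qed.

Lemma regular_uVn n : regular_at None ((u_ R)^-1 ^+ n).
Proof.
elim: n => [|n IH]; first by rewrite expr0 -of_poly1; exact: (regular_cst None 1).
by rewrite exprS; apply: regularM => //; exact: regular_uV.
Qed.

Lemma regular_rsubst f : regular_at None (rsubst f (u_ R)^-1).
Proof.
elim/poly_ind: f => [|f c IH].
  by rewrite -[0]/(0%:P : {poly K}) rsubstC; exact: regular_cst.
rewrite rsubstD rsubstM rsubstC rsubstX; apply: regularD; last exact: regular_cst.
by apply: regularM => //; exact: regular_uV.
Qed.

Lemma regular_of_poly x p : regular_at (Some x) (of_poly p).
Proof. by exists p, 1; rewrite hornerC oner_eq0 of_poly1 divr1. Qed.

Lemma regular_infty_size p : regular_at None (of_poly p) -> (size p <= 1)%N.
Proof.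
move=> [r [q [q0 rq e]]]; have [->|p0] := eqVneq p 0; first by rewrite size_poly0.
have pqr : p * q = r.
  by apply: of_poly_inj; rewrite of_polyM e divfK // of_poly_eq0.
have sq : (0 < size q)%N by rewrite size_poly_gt0.
move: rq sq; rewrite -pqr size_mul //; move: (size p) (size q) => m k; lia.
Qed.

Lemma regular_infty_expand1 h : regular_at None h ->
  exists c h', regular_at None h' /\ h = cst c + (u_ R)^-1 * h'.
Proof.
(* The value at infinity, which is 0 when deg p < deg q. *)
move=> [p [q [q0 pq ->]]]; pose c := p`_(size q).-1 / lead_coef q.
exists c, (of_poly ('X * (p - c *: q)) / of_poly q); split.
  exists ('X * (p - c *: q)), q; split=> //.
  apply: (leq_trans (size_polyMleq _ _)); rewrite size_polyX.
  have -> : size q = (size q).-1.+1 by rewrite prednK // size_poly_gt0.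
  rewrite !addSn add0n /= ltnS; apply/leq_sizeP => k; rewrite leq_eqVlt => /orP[/eqP <-|qk].
    by rewrite coefB coefZ /c /lead_coef divfK ?subrr // -lead_coefE lead_coef_eq0.
  have {}qk : (size q <= k)%N by move: qk; rewrite prednK // size_poly_gt0.
  by rewrite coefB coefZ !nth_default ?mulr0 ?subrr // (leq_trans pq).
rewrite of_polyM -[of_poly 'X]/(u_ R) of_polyB of_polyZ.
have id (L : fieldType) (x y z w : L) : x != 0 -> y != 0 ->
    z / y = w + x^-1 * (x * (z - w * y) / y).
  by move=> x0 y0; field; rewrite x0 y0.
by apply: id; [exact: u_neq0|rewrite of_poly_eq0].
Qed.

Lemma regular_infty_expand n h : regular_at None h ->
  exists f h', regular_at None h' /\ h = rsubst f (u_ R)^-1 + (u_ R)^-1 ^+ n * h'.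
Proof.
elim: n h => [|n IH] h rh.
  exists 0, h; split=> //.
  by rewrite -[0]/(0%:P : {poly K}) rsubstC cst0 add0r expr0 mul1r.
have [c [h1 [rh1 ->]]] := regular_infty_expand1 rh.
have [f [h2 [rh2 ->]]] := IH h1 rh1.
exists (c%:P + 'X * f), h2; split=> //.
by rewrite rsubstD rsubstM rsubstC rsubstX mulrDr addrA exprS mulrA.
Qed.

(** Let d be the degree of f. If d > 0, multiplying by q (u - x)^d and evaluating at x equates the
    nonzero [lead_coef f] times q(x) with 0. *)
Lemma polar_part_eq0 x f :
  regular_at (Some x) (rsubst f (u_ R - cst x)^-1) -> (size f <= 1)%N.
Proof.
move=> [p [q [q0 e]]]; rewrite leqNgt; apply/negP => f1.
have f0 : f != 0 by apply: contraTneq f1 => ->; rewrite size_poly0.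
pose w := u_ R - cst x; pose d := (size f).-1.
have wE : w = of_poly ('X - x%:P) by rewrite of_polyB.
have w0 : w != 0 by rewrite wE of_poly_eq0 polyXsubC_eq0.
pose r := \sum_(k < size f) f`_k *: ('X - x%:P) ^+ (d - k).
have rE : of_poly r = w ^+ d * rsubst f w^-1.
  rewrite rsubstE horner_coef size_map_inj_poly ?rmorph0 //; last first.
    by move=> c c' /of_poly_inj /polyC_inj.
  rewrite mulr_sumr /r [LHS](raddf_sum (@tofrac _)) /=; apply: eq_bigr => k _.
  rewrite -[tofrac _]/(of_poly _) of_polyZ of_polyXn -wE coef_map /=.
  rewrite -[tofrac _]/(cst _) mulrCA exprVn; congr (_ * _).
  have kd : (k <= d)%N by rewrite -ltnS /d prednK // size_poly_gt0.
  have id (L : fieldType) (x' : L) m n : x' != 0 -> (n <= m)%N ->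
      x' ^+ (m - n) = x' ^+ m * (x' ^+ n)^-1.
    by move=> x0 nm; rewrite -{2}(subnK nm) exprD mulfK // expf_neq0.
  exact: id.
have q1 : of_poly q != 0.
  by rewrite of_poly_eq0; apply: contra_neq q0 => ->; rewrite horner0.
have : r * q = p * ('X - x%:P) ^+ d.
  apply: of_poly_inj; rewrite !of_polyM rE e of_polyXn -wE.
  by rewrite -mulrA divfK // mulrC.
move/(congr1 (fun p => p.[x])); rewrite !hornerM horner_exp hornerXsubC subrr.
have d1 : (0 < d)%N by rewrite /d -ltnS prednK // size_poly_gt0.
rewrite expr0n eqn0Ngt d1 mulr0 => /eqP.
rewrite mulf_eq0 (negPf q0) orbF /r horner_sum.
have dlt : (d < size f)%N by rewrite /d prednK // size_poly_gt0.
rewrite (bigD1 (Ordinal dlt)) //= subnn expr0 hornerZ hornerC mulr1 big1 ?addr0.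
  by rewrite -lead_coefE lead_coef_eq0 (negPf f0).
move=> k kd; rewrite hornerZ horner_exp hornerXsubC subrr expr0n.
case: eqP => [dk|_]; last by rewrite mulr0.
case/eqP: kd; apply/val_inj/eqP; rewrite /= eqn_leq -[(d <= k)%N]subn_eq0 dk eqxx andbT.
by rewrite -ltnS /d prednK // size_poly_gt0.
Qed.

(** Comparing two decompositions gives a polynomial in 1/(u - x), or in u at infinity, that is
    regular at Q. It is constant, and its linear coefficient is c - c' up to sign. *)
Lemma has_residue_uniq Q F c c' : has_residue Q F c -> has_residue Q F c' -> c = c'.
Proof.
case: Q => [x|] /=.
  move=> [s [h [rh ->]]] [s' [h' [rh' e]]].
  set v := (u_ R - cst x)^-1 in e.
  pose f := (s - s') * 'X^2 + (c - c') *: 'X.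
  have : regular_at (Some x) (rsubst f v).
    have -> : rsubst f v = h' - h; last exact: regularB.
      rewrite /f rsubstD rsubstM rsubstB rsubstXn -mul_polyC rsubstM rsubstC rsubstX cstB.
      move: e; rewrite -/(rsubst s v) -/(rsubst s' v) => e.
      have id (L : fieldType) (z z' w w' t y y' : L) :
          z * t ^+ 2 + w * t + y = z' * t ^+ 2 + w' * t + y' ->
          (z - z') * t ^+ 2 + (w - w') * t = y' - y.
        move=> H; apply/eqP; rewrite -subr_eq0; apply/eqP.
        transitivity ((z * t ^+ 2 + w * t + y) - (z' * t ^+ 2 + w' * t + y')).
          by ring.
        by rewrite H subrr.
      exact: id e.
  move/polar_part_eq0 => fs; apply/eqP; rewrite -subr_eq0; apply/eqP.
  have := nth_default 0 fs; rewrite /f coefD coefMXn /= add0r coefZ coefX mulr1.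
  by [].
move=> [s [h [rh ->]]] [s' [h' [rh' e]]].
pose f := (s - s') * 'X^2 - (c - c') *: 'X.
have : regular_at None (of_poly f).
  have -> : of_poly f = h' - h; last exact: regularB.
    rewrite /f of_polyB of_polyM of_polyXn of_polyB of_polyZ -[of_poly 'X]/(u_ R) cstB.
    have id (L : fieldType) (z z' w w' x y y' : L) : x != 0 ->
        z - w * x^-1 + y * x ^- 2 = z' - w' * x^-1 + y' * x ^- 2 ->
        (z - z') * x ^+ 2 - (w - w') * x = y' - y.
      move=> x0 H.
      transitivity (((z - w * x^-1 + y * x ^- 2) - (z' - w' * x^-1 + y' * x ^- 2))
                    * x ^+ 2 + (y' - y)); first by field.
      by rewrite H subrr mul0r add0r.
    exact: id u_neq0 e.
move/regular_infty_size => fs; apply/eqP; rewrite -subr_eq0; apply/eqP.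
have := nth_default 0 fs; rewrite /f coefB coefMXn /= sub0r coefZ coefX mulr1.
by move/eqP; rewrite oppr_eq0 => /eqP.
Qed.

Lemma has_residueE Q F c : has_residue Q F c -> residue Q F = c.
Proof.
move=> Fc; rewrite /residue; case: xgetP => [c' _ Fc'|/(_ c) //].
exact: has_residue_uniq Fc' Fc.
Qed.

Lemma residue_regular x h : regular_at (Some x) h -> residue (Some x) h = 0.
Proof.
move=> rh; apply: has_residueE; exists 0, h; split=> //=.
by rewrite cst0 mul0r addr0 -[_.[_]]/(rsubst 0 _) -[0]/(0%:P : {poly K}) rsubstC cst0 mul0r add0r.
Qed.

Lemma has_residue_inftyD F F' c c' : has_residue None F c -> has_residue None F' c' ->
  has_residue None (F + F') (c + c').
Proof.
move=> [s [h [rh ->]]] [s' [h' [rh' ->]]]; exists (s + s'), (h + h'); split.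
  exact: regularD.
have id (L : fieldType) (z z' w w' x x' y y' : L) :
    z - w * x + y * x' + (z' - w' * x + y' * x') = z + z' - (w + w') * x + (y + y') * x'.
  by ring.
by rewrite of_polyD cstD; exact: id.
Qed.

Lemma has_residue_inftyZ b F c : has_residue None F c ->
  has_residue None (cst b * F) (b * c).
Proof.
move=> [s [h [rh ->]]]; exists (b *: s), (cst b * h); split.
  by apply: regularM => //; exact: regular_cst.
have id (L : fieldType) (z w x x' y k : L) :
    k * (z - w * x + y * x') = k * z - k * w * x + k * y * x' by ring.
by rewrite of_polyZ cstM; exact: id.
Qed.

Lemma has_residue_infty_poly p : has_residue None (of_poly p) 0.
Proof.
exists p, 0; split; first by rewrite -cst0; exact: regular_cst.
by rewrite cst0 !mul0r subr0 addr0.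
Qed.

(** Peeling off the constant term of f lowers k by one; the term removed is a polynomial in u,
    without residue at infinity. *)
Lemma has_residue_infty_monomial f k :
  has_residue None (rsubst f (u_ R)^-1 * u_ R ^+ k) (- f`_k.+1).
Proof.
elim: k f => [|k IH] f; rewrite rsubst_split; last first.
  have -> : - f`_k.+2 = 0 + - (drop_poly 1 f)`_k.+1 by rewrite add0r coef_drop_poly addn1.
  rewrite mulrDl; apply: has_residue_inftyD.
    rewrite -[u_ R]/(of_poly 'X) -of_polyXn -of_polyM; exact: has_residue_infty_poly.
  by rewrite exprS mulrAC mulKf ?u_neq0 // mulrC; exact: IH.
rewrite rsubst_split; exists (f`_0)%:P, (rsubst (drop_poly 1 (drop_poly 1 f)) (u_ R)^-1).
split; first exact: regular_rsubst.
rewrite coef_drop_poly -[of_poly _%:P]/(cst _) expr0 mulr1 -[cst (- _)]/(cst (- f`_1)).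
have id (L : fieldType) (z w x y : L) :
    z + x * (w + x * y) = z - (- w) * x + y * x ^+ 2 by ring.
rewrite -[- f`_1]sub0r cstB cst0 sub0r -exprVn; exact: id.
Qed.

Lemma residue_infty f p :
  has_residue None (rsubst f (u_ R)^-1 * of_poly p) (- pairing f p).
Proof.
have -> : of_poly p = \sum_(k < size p) cst p`_k * u_ R ^+ k.
  rewrite -{1}(coefK p) poly_def [LHS](raddf_sum (@tofrac _)) /=.
  by apply: eq_bigr => k _; rewrite -of_polyXn -of_polyZ.
rewrite /pairing -sumrN mulr_sumr.
have z : has_residue None (0 : ratfun) 0.
  by rewrite -of_poly0; exact: has_residue_infty_poly.
elim/big_rec2: _ => // k F c _ IH; apply: has_residue_inftyD => //.
rewrite mulrCA -mulrN.
by apply: has_residue_inftyZ; exact: has_residue_infty_monomial.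
Qed.

End RationalFunctions.

(** * Regular differentials as the orthogonal of the singular local ring *)

Section CurveDuality.

Variables (R : realType) (C : rational_curve R) (g : nat) (S : point_of C).
Local Notation K := R[i].
Hypothesis S_unique_singular : forall P : point_of C, ~ smooth P <-> P = S.
Hypothesis S_unibranch : exists! Q : P1 R, nu C Q = S.
Hypothesis S_infty : nu C None = S.

Lemma nu_infty Q : nu C Q = S -> Q = None.
Proof.
by case: S_unibranch => Q0 [_ uniq] QS; rewrite -(uniq Q QS) (uniq None S_infty).
Qed.

Lemma finite_smooth (p : K) : smooth (nu C (Some p)).
Proof. by apply: contrapT => /S_unique_singular /nu_infty. Qed.

(* t = 1/u is a local coordinate on the branch at the singular point. *)
Let V (f : {poly K}) : Prop := locring S (rsubst f (u_ R)^-1).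

(** Write a conductor element as d = p / q. Then h / u^n is d times q h / (p u^n), which is regular
    at infinity once n >= [size q]. *)
Lemma locring_conductor : exists N, forall n h, (N <= n)%N -> regular_at None h ->
  locring S ((u_ R)^-1 ^+ n * h).
Proof.
have [d d0 dS] := curve_finite S.
have /dS : forall Q, nu C Q = S -> regular_at Q (1 : ratfun R).
  by move=> Q _; rewrite -of_poly1; exact: regular_cst.
rewrite mulr1 => dreg; have := locring_regular dreg S_infty => -[p [q [q0 pq dE]]].
have p0 : p != 0 by apply: contra_neq d0 => p0; rewrite dE p0 of_poly0 mul0r.
exists (size q) => n h nq rh.
have -> : (u_ R)^-1 ^+ n * h = d * ((of_poly q / of_poly (p * 'X^n)) * h).
  have id (L : fieldType) (x y z w : L) : x != 0 -> y != 0 -> z != 0 ->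
      z^-1 * w = x / y * (y / (x * z) * w).
    by move=> x0 y0 z0; field; rewrite x0 y0 z0.
  rewrite dE of_polyM of_polyXn exprVn.
  exact: (id (ratfun R) _ _ _ _ (of_poly_neq0 p0) (of_poly_neq0 q0) (expf_neq0 n (u_neq0 R))).
apply: dS => Q /nu_infty ->; apply: regularM => //.
exists q, (p * 'X^n); split=> //; first by rewrite mulf_neq0 // monic_neq0 // monicXn.
rewrite size_mulXn //; have := size_poly_gt0 p; rewrite p0; lia.
Qed.

Lemma omega_stalk_pairing p f : omega_stalk S (of_poly p) -> V f -> pairing f p = 0.
Proof.
move=> H /H; rewrite (_ : [set Q | nu C Q = S] = [set None]); last first.
  by apply/seteqP; split=> [Q /nu_infty //|Q ->].
rewrite fsbig_set1 (has_residueE (residue_infty f p)) => /eqP.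
by rewrite oppr_eq0 => /eqP.
Qed.

(** At the singular point a local function is a polynomial in 1/u lying in V, plus a remainder too
    small to produce a residue. Elsewhere the product is regular. *)
Lemma H0omega_of_poly p : (forall f, V f -> pairing f p = 0) -> H0omega C (of_poly p).
Proof.
move=> Hp P f fP; have [PS|PS] := pselect (P = S).
  rewrite {}PS in fP *.
  rewrite (_ : [set Q | nu C Q = S] = [set None]); last first.
    by apply/seteqP; split=> [Q /nu_infty //|Q ->].
  rewrite fsbig_set1; apply: has_residueE.
  have [N NS] := locring_conductor.
  (* N puts the remainder in the local ring, [size p] absorbs the pole of p at infinity, and the
     last factor 1 / u^2 excludes a residue. *)
  have [s [h [rh fE]]] := regular_infty_expand (N + size p + 2) (locring_regular fP S_infty).
  have Vs : V s.
    rewrite /V -[rsubst _ _](addrK ((u_ R)^-1 ^+ (N + size p + 2) * h)) -fE.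
    by apply: locring_sub => //; apply: NS => //; lia.
  rewrite fE mulrDl -[0]addr0; apply: has_residue_inftyD.
    by have := residue_infty s p; rewrite Hp // oppr0.
  have rp : regular_at None (of_poly p * (u_ R)^-1 ^+ size p).
    exists p, 'X^(size p); split; first by rewrite monic_neq0 // monicXn.
      by rewrite size_polyXn.
    by rewrite of_polyXn exprVn.
  exists 0, ((u_ R)^-1 ^+ N * h * (of_poly p * (u_ R)^-1 ^+ size p)); split.
    by apply: regularM => //; apply: regularM => //; exact: regular_uVn.
  have id (L : fieldType) (t h' q : L) m n :
    t^-1 ^+ (m + n + 2) * h' * q = 0 - 0 * t^-1 + t^-1 ^+ m * h' * (q * t^-1 ^+ n) * t ^- 2.
    by rewrite !exprD -exprVn; ring.
  rewrite of_poly0 cst0; exact: id.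
have [P0 [nuP locP]] : smooth P by apply: contrapT => /S_unique_singular.
case: P0 => [x|] in nuP locP *; last first.
  by case: PS; rewrite -S_infty; apply/esym/nuP.
rewrite (_ : [set Q | nu C Q = P] = [set Some x]); last first.
  by apply/seteqP; split=> Q /=; rewrite nuP.
rewrite fsbig_set1 residue_regular //; apply: regularM; last exact: regular_of_poly.
by rewrite -locP.
Qed.

Variables (omega : 'I_g -> ratfun R) (a : 'I_g -> {poly K}).
Hypothesis omega_basis : is_basis_of (H0omega C) omega.
Hypothesis omega_poly : forall j : 'I_g, omega j = of_poly (a j).

Let of_poly_sum (c : 'I_g -> K) :
  \sum_j Defs.cst (c j) * omega j = of_poly (\sum_j c j *: a j).
Proof.
rewrite [RHS](raddf_sum (@tofrac _)) /=.
by apply: eq_bigr => j _; rewrite omega_poly -of_polyZ.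
Qed.

Let H0omega_span p : (forall f, V f -> pairing f p = 0) ->
  exists! c : 'rV[K]_g, p = \sum_j c 0 j *: a j.
Proof.
move=> /H0omega_of_poly Hp; have [_ /(_ _ Hp) [c [cE cu]]] := omega_basis.
exists c; split=> [|c' c'E].
  by apply: of_poly_inj; rewrite -(of_poly_sum (fun j => c 0 j)).
by apply: cu; rewrite (of_poly_sum (fun j => c' 0 j)) -c'E.
Qed.

Lemma differentials_free (c : 'I_g -> K) : \sum_j c j *: a j = 0 -> forall j, c j = 0.
Proof.
move=> c0 j; have [|c' [_ cu]] := @H0omega_span 0.
  by move=> f _; rewrite /pairing size_poly0 big_ord0.
have c'0 : c' = 0.
  by apply: cu; rewrite big1 // => i _; rewrite mxE scale0r.
have c'c : c' = \row_j c j.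
  by apply: cu; rewrite -[LHS]c0; apply: eq_bigr => i _; rewrite mxE.
have := congr1 (fun w : 'rV[K]_g => w 0 j) c'c.
by rewrite c'0 !mxE.
Qed.

Lemma tau_num_curve : exists T : mpoly g K, forall x : nat -> K,
  tau_num a x = meval (fun j => \sum_(k < size (a j)) (a j)`_k * x k) T.
Proof.
have [N NS] := locring_conductor.
apply: (@tau_num_factor R g a V N).
- by move=> c; rewrite /V rsubstC; exact: locring_cst.
- by move=> f h Vf Vh; rewrite /V rsubstB; exact: locring_sub.
- by move=> f h Vf Vh; rewrite /V rsubstM; exact: locring_mul.
- by move=> f; rewrite /V rsubstM rsubstXn; apply: NS => //; exact: regular_rsubst.
- move=> f j; apply: omega_stalk_pairing; rewrite -omega_poly.
  by case: omega_basis => /(_ j) /(_ S).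
- by move=> p /H0omega_span [c [cE _]]; exists (fun j => c 0 j).
- exact: differentials_free.
Qed.

End CurveDuality.

(** * The Abel map and the exponential *)

Section ComplexFacts.

Variable R : realType.
Local Notation K := R[i].

(** Polar coordinates: the argument is acos(x / r), with the sign of y. *)
Lemma cexp_surj (z : K) : z != 0 -> exists c : K, cexp c = z.
Proof.
case: z => x y z0; pose r := Num.sqrt (x ^+ 2 + y ^+ 2).
have s0 : 0 < x ^+ 2 + y ^+ 2.
  rewrite lt0r addr_ge0 ?sqr_ge0 // andbT paddr_eq0 ?sqr_ge0 // !sqrf_eq0.
  by apply: contra z0 => /andP[/eqP -> /eqP ->].
have r0 : 0 < r by rewrite sqrtr_gt0.
have rn0 : r != 0 by rewrite gt_eqF.
have r2 : r ^+ 2 = x ^+ 2 + y ^+ 2 by rewrite sqr_sqrtr // ltW.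
pose w := x / r.
have w2 : 1 - w ^+ 2 = (y / r) ^+ 2.
  by rewrite /w !expr_div_n r2; field; rewrite gt_eqF.
have w1 : -1 <= w <= 1.
  by rewrite -ler_norml -(@expr_le1 _ 2) // -normrX ger0_norm ?sqr_ge0 // -subr_ge0 w2 sqr_ge0.
have cosw : cos (acos w) = w by case/acos_def: w1.
have sinw : sin (acos w) = `|y| / r.
  by rewrite sin_acos // w2 sqrtr_sqr normrM normfV (gtr0_norm r0).
have [y0|y0] := leP 0 y.
  exists (Complex (ln r) (acos w)); rewrite /cexp /= lnK // cosw sinw ger0_norm //.
  by congr Complex; rewrite mulrC divfK.
exists (Complex (ln r) (- acos w)); rewrite /cexp /= lnK // cosN sinN cosw sinw ltr0_norm //.
by congr Complex; rewrite ?mulNr ?opprK mulrC divfK.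
Qed.

Lemma integral_deriv_horner (G : {poly R}) :
  \int[lebesgue_measure]_(t in `[0%R, 1%R]) (G^`()).[t] = G.[1] - G.[0].
Proof.
rewrite /Rintegral (@continuous_FTC2 R (horner G^`()) (horner G)) //.
- by apply: continuous_subspaceT; exact: continuous_horner.
- split=> [t _||]; first exact: derivable_horner.
  + by apply: cvg_at_right_filter; exact: continuous_horner.
  + by apply: cvg_at_left_filter; exact: continuous_horner.
- by move=> t _; rewrite derivE.
Qed.

Lemma Re_horner (H : {poly K}) (t : R) :
  complex.Re H.[(t%:C)%C] = (map_poly (@complex.Re R) H).[t].
Proof.
have ReM (x : K) s : complex.Re (x * (s%:C)%C) = complex.Re x * s.
  by case: x => x y /=; rewrite mulr0 subr0.
rewrite (horner_coef_wide _ (size_poly _ _)) horner_coef raddf_sum.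
by apply: eq_bigr => k _; rewrite coef_map -rmorphXn; exact: ReM.
Qed.

Lemma Im_horner (H : {poly K}) (t : R) :
  complex.Im H.[(t%:C)%C] = (map_poly (@complex.Im R) H).[t].
Proof.
have ImM (x : K) s : complex.Im (x * (s%:C)%C) = complex.Im x * s.
  by case: x => x y /=; rewrite mulr0 add0r.
rewrite (horner_coef_wide _ (size_poly _ _)) horner_coef raddf_sum.
by apply: eq_bigr => k _; rewrite coef_map -rmorphXn; exact: ImM.
Qed.

Definition antideriv (F : {poly K}) : {poly K} :=
  \poly_(i < (size F).+1) (if i is i'.+1 then F`_i' / i'.+1%:R else 0).

Lemma deriv_antideriv F : (antideriv F)^`() = F.
Proof.
apply/polyP => k; rewrite coef_deriv coef_poly ltnS; case: ltnP => kF.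
  by rewrite -[LHS]mulr_natr divfK // pnatr_eq0.
by rewrite mul0rn nth_default.
Qed.

Lemma horner_antideriv F p : (antideriv F).[p] = \sum_(k < size F) F`_k * pt p k.
Proof.
rewrite (horner_coef_wide _ (size_poly _ _)) big_ord_recl coef_poly mul0r add0r.
by apply: eq_bigr => k _; rewrite coef_poly /= /bump /= add1n ltnS ltn_ord /pt; ring.
Qed.

(** The integrand is the derivative of G(t p) in t, for a primitive G of F; its real and imaginary
    parts are real polynomials in t. *)
Lemma segment_integralE (F : {poly K}) (p : K) :
  segment_integral F p = \sum_(k < size F) F`_k * pt p k.
Proof.
rewrite -horner_antideriv; set G := antideriv F.
pose H := G \Po (p *: 'X).
have dH (t : R) : F.[(t%:C)%C * p] * p = H^`().[(t%:C)%C].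
  rewrite /H deriv_comp deriv_antideriv derivZ derivX alg_polyC hornerM hornerC.
  by rewrite horner_comp hornerZ hornerX (mulrC p).
have G0 : G.[0] = 0 by rewrite horner_coef0 coef_poly.
have H1 : H.[(1%:C)%C] = G.[p] by rewrite horner_comp hornerZ hornerX mulr1.
have H0 : H.[(0%:C)%C] = 0 by rewrite horner_comp hornerZ hornerX mulr0.
have dRe : map_poly (@complex.Re R) H^`() = (map_poly (@complex.Re R) H)^`().
  by apply/polyP => k; rewrite coef_map !coef_deriv coef_map raddfMn.
have dIm : map_poly (@complex.Im R) H^`() = (map_poly (@complex.Im R) H)^`().
  by apply/polyP => k; rewrite coef_map !coef_deriv coef_map raddfMn.
rewrite /segment_integral.
under eq_Rintegral do rewrite dH Re_horner dRe.
rewrite integral_deriv_horner -!Re_horner H1 H0 subr0.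
under eq_Rintegral do rewrite dH Im_horner dIm.
rewrite integral_deriv_horner -!Im_horner H1 H0 subr0.
by case: (G.[p]).
Qed.

End ComplexFacts.

(** * The theta function *)

Section Cofactor.

Variables (R : realType) (g : nat) (a : 'I_g -> {poly R[i]}).
Local Notation K := R[i].
Variables (T theta r : mpoly g K).

Let alpha j : {poly K} := antideriv (a j).

Definition abel_sum n (p : 'I_n -> K) (j : 'I_g) : K := \sum_i (alpha j).[p i].

Lemma abel_sumE n (p : 'I_n -> K) j :
  abel_sum p j = \sum_(k < size (a j)) (a j)`_k * \sum_i pt (p i) k.
Proof.
rewrite /abel_sum; under eq_bigr do rewrite horner_antideriv.
by rewrite exchange_big; apply: eq_bigr => k _; rewrite mulr_sumr.
Qed.

Hypothesis a_free : forall c : 'I_g -> K, \sum_j c j *: a j = 0 -> forall j, c j = 0.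
Hypothesis TE : forall x : nat -> K,
  tau_num a x = meval (fun j => \sum_(k < size (a j)) (a j)`_k * x k) T.
Hypothesis Tr : T = r * theta.
Hypothesis theta0 : forall p : 'I_g.-1 -> K, meval (abel_sum p) theta = 0.

(** The Jacobian determinant of [abel_sum] on g points. *)
Let J (p : 'I_g -> K) : K := \det (\matrix_(j, i) (a j).[p i]).

Let alpha0 j : (alpha j).[0] = 0.
Proof. by rewrite horner_coef0 coef_poly. Qed.

Let tau_neq0 (p : 'I_g -> K) : (forall i, p i != 0) -> J p != 0 ->
  meval (abel_sum p) T != 0.
Proof.
move=> pn0 Jp; have := tau_num_pts_neq0 pn0 Jp; rewrite TE.
by rewrite (@meval_eq _ _ _ (abel_sum p)) // => j; rewrite abel_sumE.
Qed.

Let J_inj (p : 'I_g -> K) : J p != 0 -> injective p.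
Proof.
move=> Jp i k pik; apply/eqP; apply: contraNT Jp => ik.
rewrite /J -det_tr; apply/eqP; apply: (determinant_alternate ik) => j.
by rewrite !mxE pik.
Qed.

(* As a polynomial in s, T(abel_sum p - abel s) has degree at most g, while
   theta(abel_sum p - abel s) already has the g distinct roots p_i. *)
Let cofactor_invariant_generic (p : 'I_g -> K) s : (forall i, p i != 0) -> J p != 0 ->
  meval (fun j => abel_sum p j - (alpha j).[s]) r = meval (abel_sum p) r.
Proof.
move=> pn0 Jp; pose h j : {poly K} := (abel_sum p j)%:P - alpha j.
have hE (q : mpoly g K) y : (mmap polyC h q).[y] = meval (fun j => abel_sum p j - (alpha j).[y]) q.
  rewrite horner_mmap; apply: meval_eq => j.
  by rewrite hornerD hornerN hornerC.
have [P [Psize PE]] := tau_num_subpt a (fun n => \sum_i pt (p i) n).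
have PrT : P = mmap polyC h r * mmap polyC h theta.
  apply/eqP; rewrite -subr_eq0; apply/eqP; apply: poly_eq0 => y.
  rewrite hornerD hornerN hornerM !hE PE TE -mevalM -Tr.
  apply/eqP; rewrite subr_eq0; apply/eqP; apply: meval_eq => j.
  rewrite abel_sumE horner_antideriv -sumrB; apply: eq_bigr => k _.
  by rewrite mulrBr.
have h0 (q : mpoly g K) : (mmap polyC h q).[0] = meval (abel_sum p) q.
  by rewrite hE; apply: meval_eq => j; rewrite alpha0 subr0.
have Pn0 : P != 0.
  apply: contraTneq (tau_neq0 pn0 Jp) => P0.
  by rewrite Tr mevalM -!h0 -hornerM -PrT P0 horner0 eqxx.
have thn0 : mmap polyC h theta != 0.
  by apply: contra_neq Pn0 => th0; rewrite PrT th0 mulr0.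
have rn0 : mmap polyC h r != 0.
  by apply: contra_neq Pn0 => rh0; rewrite PrT rh0 mul0r.
(* At s = p_i the i-th point cancels and theta vanishes on the g - 1 points left; [J_inj] makes
   these roots distinct. *)
have thsize : (g < size (mmap polyC h theta))%N.
  have cp : size (codom p) = g by rewrite size_codom card_ord.
  rewrite -[X in (X < _)%N]cp.
  apply: max_poly_roots => //; last by rewrite map_inj_uniq ?enum_uniq //; exact: J_inj.
  apply/allP => y /codomP[i ->]; rewrite rootE hE.
  rewrite -[X in _ == X](theta0 (fun k => p (lift i k))); apply/eqP.
  apply: meval_eq => j; rewrite /abel_sum (bigD1_ord i) //= addrAC subrr add0r.
  by [].
have rsize : (size (mmap polyC h r) <= 1)%N.
  move: Psize; rewrite PrT size_mul //.
  by move: (size _) (size _) thsize => m n; lia.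
have [c rc] : {c | mmap polyC h r = c%:P}.
  by exists (mmap polyC h r)`_0; rewrite [LHS]size1_polyC.
by rewrite -hE -h0 rc !hornerC.
Qed.

Let generic_exists : exists p : 'I_g -> K, (forall i, p i != 0) /\ J p != 0.
Proof. exact: evaluation_det_neq0. Qed.

Let alpha_polyfun j n i : @polyfun K n (fun p => (alpha j).[p i]).
Proof. by apply: polyfun_horner; exact: polyfun_var. Qed.

Let dense (F : ('I_g -> K) -> K) : polyfun F -> (forall p : 'I_g -> K, F (abel_sum p) = 0) ->
  forall z, F z = 0.
Proof.
move=> [f fE] F0 z; rewrite fE (_ : f = 0) ?meval0 //.
apply: (@curve_sums_dense _ g alpha) => [|p]; last by rewrite -fE F0.
have [p [_ Jp]] := generic_exists; exists p.
by rewrite (_ : (\matrix_(j, i) _) = \matrix_(j, i) (a j).[p i]) //;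
  apply/matrixP => j i; rewrite !mxE deriv_antideriv.
Qed.

(** The generic case is multiplied by the polynomial G that vanishes off it, which gives all sums of
    g points, and density gives all z. *)
Let cofactor_invariant s z : meval (fun j => z j - (alpha j).[s]) r = meval z r.
Proof.
pose F z := meval (fun j => z j - (alpha j).[s]) r - meval z r.
have PF : polyfun F.
  apply: polyfunD.
    apply: polyfun_meval => j; apply: polyfunD; first exact: polyfun_var.
    exact: polyfun_cst.
  by apply: polyfunN; exists r.
suff F0 : F z = 0 by apply/eqP; rewrite -subr_eq0 -[X in X == _]/(F z) F0.
apply: dense => // p.
pose G (p : 'I_g -> K) := (\prod_i p i) * J p.
move: p; apply: (@polyfunM_eq0 K g (fun p => F (abel_sum p)) G).
- have [f fE] := PF; rewrite (_ : (fun p => _) = (fun p => meval (abel_sum p) f)).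
    by apply: polyfun_meval => j; apply: polyfun_sum => i _; exact: alpha_polyfun.
  by apply/funext => p; rewrite fE.
- apply: polyfunM; first by apply: polyfun_prod => i _; exact: polyfun_var.
  by apply: polyfun_det => j i; apply: polyfun_horner; exact: polyfun_var.
- move=> p; have [->|Gp] := eqVneq (G p) 0; first by rewrite mulr0.
  move: Gp; rewrite /G mulf_eq0 negb_or => /andP[/prodf_neq0 pn0 Jp].
  rewrite /F cofactor_invariant_generic ?subrr ?mul0r // => i; exact: pn0.
have [p [pn0 Jp]] := generic_exists; exists p.
by rewrite /G mulf_neq0 //; apply/prodf_neq0 => i _.
Qed.

(** Subtracting g points one by one from 0 shows that r equals r(0) at the opposites of all Abel
    sums, which are dense. *)
Lemma theta_cofactor_cst : exists c : K, c != 0 /\ T = c *: theta.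
Proof.
have inv (s : seq K) z :
    meval (fun j => z j - \sum_(p <- s) (alpha j).[p]) r = meval z r.
  elim: s z => [|p s IH] z.
    by apply: meval_eq => j; rewrite big_nil subr0.
  rewrite -[RHS](cofactor_invariant p) -[RHS]IH; apply: meval_eq => j.
  by rewrite big_cons opprD addrA.
pose c := meval (fun=> 0) r.
have rc z : meval (fun j => - z j) r - c = 0.
  pose F (z : 'I_g -> K) := meval (fun j => - z j) r - c.
  apply: (@dense F) => [|p].
    apply: polyfunD; last exact: polyfun_cst.
    by apply: polyfun_meval => j; apply: polyfunN; exact: polyfun_var.
  rewrite /F /c -(inv [seq p i | i <- enum 'I_g] (fun=> 0)).
  apply/eqP; rewrite subr_eq0; apply/eqP; apply: meval_eq => j.
  by rewrite sub0r big_map big_enum.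
have rE : r = mpolyC g c.
  apply/eqP; rewrite -subr_eq0; apply/eqP; apply: meval_eq0 => z.
  rewrite mevalB mevalC -[RHS](rc (fun j => - z j)); congr (_ - _).
  by apply: meval_eq => j; rewrite opprK.
exists c; split; last by rewrite Tr rE mul_mpolyC.
have [p [pn0 Jp]] := generic_exists.
apply: contraTneq (tau_neq0 pn0 Jp) => c0.
by rewrite Tr rE c0 mpolyC0 mul0r meval0 eqxx.
Qed.

End Cofactor.

(** * From values at points to an identity in formal variables *)

Section FormalIdentity.

Variables (R : realType) (g : nat) (a : 'I_g -> {poly R[i]}) (theta : mpoly g R[i]).
Local Notation K := R[i].

Lemma theta_at_morph (A B : comAlgType K) (phi : {rmorphism A -> B}) (z : 'I_g -> A) :
  (forall c y, phi (c *: y) = c *: phi y) ->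
  phi (theta_at theta z) = theta_at theta (phi \o z).
Proof.
move=> phiZ; rewrite /theta_at /mmap rmorph_sum; apply: eq_bigr => m _.
rewrite rmorphM /= phiZ rmorph1 rmorph_prod; congr (_ * _).
by apply: eq_bigr => i _; rewrite rmorphXn.
Qed.

Lemma theta_at_meval (z : 'I_g -> K) : @theta_at R g theta K^o z = meval z theta.
Proof.
rewrite /theta_at /meval /mmap; apply: eq_bigr => m _; congr (_ * _).
exact: mulr1.
Qed.

(** Only N variables occur. The identity holds in [mpoly N K] because all values agree, and a
    morphism carries it to the formal variables. *)
Lemma tau_det_xvar c :
  (forall x : nat -> K,
    tau_num a x = c * meval (fun j => \sum_(k < size (a j)) (a j)`_k * x k) theta) ->
  tau_det a (@xvar R) = c *: theta_at theta (period_matrix_mul a (@xvar R)).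
Proof.
move=> tauE; pose N := (\max_j size (a j))%N.
have aN j : (size (a j) <= N)%N by exact: (leq_bigmax j).
pose X i : mpoly N K := if insub i is Some i' then mpolyX K (mnm1 (i' : 'I_N)) else 0.
have idX : tau_det a X = c *: theta_at theta (period_matrix_mul a X).
  apply/eqP; rewrite -subr_eq0; apply/eqP; apply: meval_eq0 => v.
  rewrite mevalB mevalZ; apply/eqP; rewrite subr_eq0; apply/eqP.
  pose ev : {rmorphism mpoly N K -> K^o} := meval v.
  have evZ d y : ev (d *: y) = d *: ev y by exact: mevalZ.
  rewrite -[LHS]/(ev _) -(tau_det_morph a X evZ) -[LHS]/(tau_num a (ev \o X)) tauE.
  congr (_ * _); rewrite -[RHS]/(ev _) (theta_at_morph _ evZ) theta_at_meval.
  apply: meval_eq => j; rewrite /= /period_matrix_mul -[RHS]/(ev _) rmorph_sum.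
  by apply: eq_bigr => k _; rewrite evZ.
pose phi : {rmorphism mpoly N K -> xpoly R} :=
  mmap (in_alg (xpoly R)) (fun i : 'I_N => @xvar R i).
have phiZ d y : phi (d *: y) = d *: phi y.
  by rewrite /phi /= mmapZ /= -scalerAl mul1r.
have phiX i : (i < N)%N -> phi (X i) = xvar R i.
  by move=> iN; rewrite /X insubT /phi /= mmapX mmap1U.
rewrite -(@eq_tau_det R g a _ (phi \o X) (@xvar R) N) //.
rewrite (tau_det_morph a X phiZ) idX phiZ (theta_at_morph _ phiZ); congr (_ *: theta_at _ _).
apply/funext => j; rewrite /= /period_matrix_mul rmorph_sum; apply: eq_bigr => k _.
by rewrite phiZ phiX // (leq_trans _ (aN j)).
Qed.

End FormalIdentity.

Theorem theorem4p5 (R : realType) (C : rational_curve R) (g : nat)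
    (P0 S : point_of C)
    (C_gorenstein : gorenstein C)
    (C_genus : arithmetic_genus C g)
    (S_unique_singular : forall P : point_of C, ~ smooth P <-> P = S)
    (S_unibranch : exists! Q : P1 R, nu C Q = S)
    (P0_smooth : smooth P0)
    (P0_zero : nu C (Some 0) = P0)
    (S_infty : nu C None = S)
    (omega : 'I_g -> ratfun R)
    (omega_basis : is_basis_of (H0omega C) omega)
    (a : 'I_g -> {poly R[i]})
    (omega_poly : forall j : 'I_g, omega j = of_poly (a j))
    (theta : mpoly g R[i])
    (theta_theta : is_theta C a theta) :
  exists c0 : R[i],
    tau (curve_frame a) =
    series_of_xpoly (cexp c0 *: theta_at theta (period_matrix_mul a (@xvar R))).
Proof.
have [T TE] := tau_num_curve S_unique_singular S_unibranch S_infty omega_basis omega_poly.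
have a_free := differentials_free S_unique_singular S_unibranch S_infty omega_basis omega_poly.
case: theta_theta => theta_neq0 theta_reduced theta_zeros.
(* All finite points are smooth, so the parameters are unrestricted. *)
have abelP (p : 'I_g.-1 -> R[i]) : abel_image C a (abel_sum a p).
  exists p; split=> [k|j].
    exact: finite_smooth S_unique_singular S_unibranch S_infty (p k).
  by apply: eq_bigr => k _; rewrite segment_integralE horner_antideriv.
have theta0 (p : 'I_g.-1 -> R[i]) : meval (abel_sum a p) theta = 0.
  have : [set z | meval z theta = 0] (abel_sum a p).
    by rewrite theta_zeros => q; apply; exact: abelP.
  by [].
(* For g = 0 the truncated [g.-1] is 0, the Abel image is the only point of C^0, and theta would be
   zero. *)
have g0 : (0 < g)%N.
  rewrite lt0n; apply: contraNneq theta_neq0 => g0; apply/eqP/meval_eq0 => v.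
  rewrite -[RHS](theta0 (fun=> 0)); apply: meval_eq => j.
  by have := ltn_ord j; rewrite [X in (_ < X)%N]g0.
(* T itself is a test polynomial for the Zariski closure of the Abel image. *)
have T0 z : meval z theta = 0 -> meval z T = 0.
  move=> z0; have : [set z | meval z theta = 0] z by [].
  rewrite theta_zeros; apply => s [p [_ sE]].
  rewrite -[RHS](@tau_num_pts_eq0 R g a [seq p k | k <- enum 'I_g.-1]); last first.
    by rewrite size_map size_enum_ord prednK.
  rewrite TE; apply: meval_eq => j; rewrite sE.
  under eq_bigr do rewrite segment_integralE.
  rewrite exchange_big; apply: eq_bigr => k _.
  by rewrite -mulr_sumr big_map big_enum.
have [d [q qE]] := hypersurface_nullstellensatz theta_neq0 T0.
have [r Tr] : exists r, T = r * theta by apply: (theta_reduced T d); exists q.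
have [c [c0 Tc]] := theta_cofactor_cst a_free TE Tr theta0.
have [c' cE] := cexp_surj c0.
exists c'; rewrite tau_curve cE; congr series_of_xpoly; apply: tau_det_xvar => x.
by rewrite TE Tc mevalZ.
Qed.
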